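(* Let $(X_1,Y_1),\dots,(X_n,Y_n)$ be independent copies of $(X,Y)\in[0,1]\times\mathbb R$, with $\mu(x)=\mathbb E(Y|X=x)$ and $\varepsilon=Y-\mu(X)$. Assume that there exist $K>0$ and $\alpha>0$ such that $\mathbb E(e^{\theta\varepsilon}|X)\le K\exp(\theta^2\alpha)$ a.e. for all $\theta\in\mathbb R$, that $X$ has a density function $f$ on $[0,1]$, that $\mu$ is nonincreasing (and differentiable) on $[0,1]$, and that there exist positive numbers $A_1,\dots,A_5$ such that $A_1<|\mu'(t)|<A_2$, $A_3<f(t)<A_4$ and $|\mu(t)|\le A_5$ for all $t\in[0,1]$. Let $\hat\mu_n$ be the nonincreasing least squares estimator of $\mu$, and $\hat\mu_n^{-1}$, $\mu^{-1}$ the generalized inverses of $\hat\mu_n$, $\mu$. Then, for any $p\ge1$, there exists $K_p>0$ that depends only on $p,A_1,\dots,A_5,K,\alpha$ such that for all $n$: 1. $\mathbb E\left(|\hat\mu_n^{-1}(a)-\mu^{-1}(a)|^p\right)\le K_pn^{-p/3}$ for all $a\in\mathbb R$; 2. $\mathbb E\left(|\hat\mu_n(t)-\mu(t)|^p\right)\le K_pn^{-p/3}$ for all $t\in[n^{-1/3},1-n^{-1/3}]$.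
   Context: Let $X_{(1)}<\dots<X_{(n)}$ be the order statistics of $X_1,\dots,X_n$ and $Y_{(i)}$ the observation corresponding to $X_{(i)}$. $\Lambda_n$ is the continuous function on $[0,1]$, linear on each $[(i-1)/n,i/n]$, with $\Lambda_n(i/n)=\frac1n\sum_{j\le i}Y_{(j)}$ for $i=0,\dots,n$ (empty sum $=0$). $\hat\lambda_n$ is the left-hand slope of the least concave majorant of $\Lambda_n$ on $[0,1]$, with $\hat\lambda_n(0)=\lim_{t\downarrow0}\hat\lambda_n(t)$. The nonincreasing least squares estimator $\hat\mu_n$ (a minimizer of $\sum_i(Y_i-\psi(X_i))^2$ over nonincreasing $\psi:[0,1]\to\mathbb R$) is the left-continuous piecewise constant function with $\hat\mu_n(X_{(i)})=\hat\lambda_n(i/n)$, $i=1,\dots,n$, constant on $[0,X_{(1)}]$ and on $(X_{(i-1)},X_{(i)}]$ for $i=2,\dots,n$, and equal to $\hat\lambda_n(1)$ on $(X_{(n)},1]$. For a nonincreasing left-continuous $h:[0,1]\to\mathbb R$, the generalized inverse is: for $a\in\mathbb R$, $h^{-1}(a)$ is the greatest $t\in[0,1]$ with $h(t)\ge a$, with the convention that the supremum of the empty set is $0$. *)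

(* Defs.v *)
From HB Require Import structures.
From mathcomp Require Import all_boot all_order all_algebra.
From mathcomp Require Import all_classical all_reals all_analysis.
From mathcomp Require Import measurable_realfun.

Set Implicit Arguments.
Unset Strict Implicit.
Unset Printing Implicit Defensive.

Import Order.TTheory GRing.Theory Num.Theory.
Import numFieldNormedType.Exports.

Local Open Scope classical_set_scope.
Local Open Scope ring_scope.

(** * Probability *)

(* [W] is a version of E(Z | X), for [Z] integrable or nonnegative measurable:
   [W] is sigma(X)-measurable and has the same integral as [Z] over every event
   of sigma(X).  In both cases testing on [W < 0] and [W > 0] shows that [W] is
   almost surely nonnegative, resp. integrable, as soon as [Z] is. *)
Definition is_cond_exp d d' (T : measurableType d) (T' : measurableType d')
    (R : realType) (P : probability T R) (X : T -> T') (Z W : T -> \bar R) :=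
  measurable_fun [set: g_sigma_algebra_preimageType X] W /\
  forall B : set T', measurable B ->
    (\int[P]_(w in X @^-1` B) W w = \int[P]_(w in X @^-1` B) Z w)%E.

(* mu(x) = E(Y | X = x): Y is integrable and mu(X) is a version of E(Y | X). *)
Definition is_regression_function d (T : measurableType d) (R : realType)
    (P : probability T R) (X Y : T -> R) (mu : R -> R) :=
  P.-integrable [set: T] (EFin \o Y) /\
  is_cond_exp P X (EFin \o Y) (EFin \o (mu \o X)).

Definition mutually_independent d d' (T : measurableType d)
    (U : measurableType d') (R : realType) (P : probability T R) (I : finType)
    (Z : I -> T -> U) :=
  forall (J : {set I}) (B : I -> set U), (forall i, measurable (B i)) ->
    P (\bigcap_(i in [set` J]) (Z i @^-1` B i)) =
    (\prod_(i in J) P (Z i @^-1` B i))%E.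

(** * Functions on [0, 1] *)

(* Derivative relative to a set, hence one-sided at the ends of an interval. *)
Definition has_derivative_within (R : realType) (D : set R) (h : R -> R)
    (t l : R) :=
  (h s - h t) / (s - t) @[s --> within D t^'] --> l.

Definition concave_on (R : realType) (D : set R) (h : R -> R) :=
  @convex_function R R^o D (\- h).

(* Pointwise infimum of all concave functions above [g] on [0, 1]. *)
Definition least_concave_majorant (R : realType) (g : R -> R) (t : R) : R :=
  inf [set h t | h in [set h : R -> R |
    concave_on `[0, 1] h /\ (forall s, s \in `[0, 1] -> g s <= h s)]].

Definition left_slope (R : realType) (h : R -> R) (t : R) : R :=
  lim ((h t - h s) / (t - s) @[s --> t^'-]).

(* The greatest t in [0, 1] with a <= h t; [sup] is 0 on the empty set. *)
Definition generalized_inverse (R : realType) (h : R -> R) (a : R) : R :=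
  sup [set t | t \in `[0, 1] /\ a <= h t].

(** * The nonincreasing least squares estimator *)

(* A sample is a sequence of pairs (X_i, Y_i).  All indices below start at 0:
   the entry i of [order_sample s] is (X_(i+1), Y_(i+1)).  [sort] is stable, so
   ties among the X_i, if any, are broken by the original index. *)
Definition order_sample (R : realType) (s : seq (R * R)) : seq (R * R) :=
  sort (fun u v => u.1 <= v.1) s.

Definition Lambda_knot (R : realType) (s : seq (R * R)) (i : nat) : R :=
  (\sum_(j < i) (nth (0, 0) (order_sample s) j).2) / (size s)%:R.

(* Linear interpolation of the values [Lambda_knot s i] at i / n. *)
Definition Lambda (R : realType) (s : seq (R * R)) (t : R) : R :=
  let x := (size s)%:R * t in
  let i := Num.truncn x in
  Lambda_knot s i + (x - i%:R) * (Lambda_knot s i.+1 - Lambda_knot s i).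

Definition lambda_hat (R : realType) (s : seq (R * R)) (t : R) : R :=
  let slope := left_slope (least_concave_majorant (Lambda s)) in
  if t == 0 then lim (slope u @[u --> 0^'+]) else slope t.

(* [find] returns the i such that X_(i) < t <= X_(i+1) (with X_(0) = -oo), and n
   if t > X_(n); the value is lambda_hat ((i + 1) / n), resp. lambda_hat 1. *)
Definition mu_hat (R : realType) (s : seq (R * R)) (t : R) : R :=
  let n := size s in
  let i := find (fun u => t <= u.1) (order_sample s) in
  lambda_hat s ((minn i.+1 n)%:R / n%:R).

(* Main.v *)
Require Import Defs.
From HB Require Import structures.
From mathcomp Require Import all_boot all_order all_algebra.
From mathcomp Require Import all_classical all_reals all_analysis.
From mathcomp Require Import measurable_realfun.
From mathcomp Require Import zify ring lra.

Set Implicit Arguments.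
Unset Strict Implicit.
Unset Printing Implicit Defensive.

Import Order.TTheory GRing.Theory Num.Theory.
Import numFieldNormedType.Exports.

Local Open Scope classical_set_scope.
Local Open Scope ring_scope.

(** The left slopes of the least concave majorant obey a max-min formula: if
    [a <= mu_hat t] then, starting from any [t0 <= t] with a sample to its right,
    some interval [[t0, v]] with [v >= t] carries a nonnegative sum of the [Y - a];
    if [mu_hat t < a] the same holds with the sides and signs exchanged.  When [mu]
    crosses the level [a] at [t0], the noise accumulated over [[t0, v]] has thus
    beaten the drift [A1 * \sum (X - t0)], which is of order [n (v - t0)^2].  Sums of
    the noise over a fixed interval have Gaussian tails (only independence of the
    pairs is used, never conditioning on the design), dyadic chaining extends
    this to the supremum over [v] in [[t0, t0 + z]] without losing a logarithm, and
    peeling over [z] shows that [|t - t0| >= x] has probability at most a constant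
    times any given power of [1 / (n x^3)].  Summing over [x = 2^k n^(-1/3)] gives
    the moments. *)

(** * Least concave majorants and their left slopes *)

(** The estimator is never shown to be measurable in the sample point; each tail bound therefore
    exhibits a measurable event containing the deviation, and the moments are bounded through these
    events. Exponential tails are traded for powers [(q / y) ^ q] with one fixed [q], so that the
    unions over cells, levels and scales reduce to geometric sums. For the pointwise bound, a
    deviation [x] at [t] shifts the level by about [x / 2], and the crossing point by an amount of
    order [x] as long as the level stays in the range of [mu]. Near an end of [0, 1] it may leave
    this range. The distance [h] to the crossing point may then be as small as n^(-1/3), and the gap
    [delta] between the level and the end value of [mu] supplies the missing drift. The controlling
    quantity is n h (delta + h)^2, which yields only the square of x n^(1/3) and stops growing once
    [x] passes 1. Up to deviations of order [n] this loss is repaired by doubling the power, hence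
    the even [q]. *)

Lemma concave_onP (R : realType) (h : R -> R) :
  concave_on `[0, 1] h <->
  forall t x y : R, 0 <= t <= 1 -> 0 <= x <= 1 -> 0 <= y <= 1 ->
    t * h x + (1 - t) * h y <= h (t * x + (1 - t) * y).
Proof.
split=> [ch t x y /andP[t0 t1] x01 y01|ch t x y].
  have t01 : (0 <= t <= 1)%R by rewrite t0.
  have := ch (Itv01 t0 t1) x y; rewrite !inE/= !in_itv/= => /(_ x01 y01).
  by rewrite !convRE /= /unstable.onem /GRing.scale/=; nra.
rewrite !inE/= !in_itv/= => x01 y01.
have t01 : 0 <= t%:num <= 1 by apply/andP; split; [exact: ge0|exact: le1].
have := ch t%:num x y t01 x01 y01.
by rewrite !convRE /= /unstable.onem /GRing.scale/=; nra.
Qed.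

Section least_concave_majorant.
Context (R : realType) (g : R -> R) (M : R).
Hypothesis gM : forall t, 0 <= t <= 1 -> g t <= M.
Let G := least_concave_majorant g.

Let concave_majorants := [set h : R -> R |
    concave_on `[0, 1] h /\ (forall s, s \in `[0, 1] -> g s <= h s)].

(** The constant [M] is a concave majorant. If there were none, [inf] would return the default value
    0, unrelated to [g]. *)
Let majorants_neq0 t : [set h t | h in concave_majorants] !=set0.
Proof.
exists M, (cst M) => //; split => [|s]; last by rewrite in_itv/=; exact: gM.
by apply/concave_onP => u x y _ _ _ /=; rewrite -mulrDl addrC subrK mul1r.
Qed.

Lemma least_concave_majorant_ge t : 0 <= t <= 1 -> g t <= G t.
Proof.
move=> t01; apply: lb_le_inf => // _ [h [_ gh] <-]; apply: gh.
by rewrite in_itv.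
Qed.

Lemma least_concave_majorant_le (h : R -> R) t : 0 <= t <= 1 -> concave_on `[0, 1] h ->
  (forall s, 0 <= s <= 1 -> g s <= h s) -> G t <= h t.
Proof.
move=> t01 ch gh; apply: ge_inf.
  by exists (g t) => _ [k [_ gk] <-]; apply: gk; rewrite in_itv.
by exists h => //; split => // s; rewrite in_itv/=; exact: gh.
Qed.

Lemma least_concave_majorant_concave t x y : 0 <= t <= 1 -> 0 <= x <= 1 -> 0 <= y <= 1 ->
  t * G x + (1 - t) * G y <= G (t * x + (1 - t) * y).
Proof.
move=> t01 x01 y01; apply: lb_le_inf => // _ [h [/[dup] ch /concave_onP ch'] gh <-].
apply: le_trans (ch' _ _ _ t01 x01 y01).
have gh' s : 0 <= s <= 1 -> g s <= h s by move=> s01; apply: gh; rewrite in_itv.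
by case/andP: t01 => t0 t1; apply: lerD; apply: ler_wpM2l; rewrite ?subr_ge0//; exact: least_concave_majorant_le.
Qed.

Lemma least_concave_majorant_chord x y z : 0 <= x -> x < y -> y < z -> z <= 1 ->
  (z - y) * G x + (y - x) * G z <= (z - x) * G y.
Proof.
move=> x0 xy yz z1; have zx : 0 < z - x by rewrite subr_gt0 (lt_trans xy).
have t01 : 0 <= (z - y) / (z - x) <= 1.
  by rewrite divr_ge0 ?(ltW zx)// ?subr_ge0 ?(ltW yz)//= ler_pdivrMr// mul1r lerB// ltW.
have x01 : 0 <= x <= 1 by lra.
have z01 : 0 <= z <= 1 by lra.
have := least_concave_majorant_concave t01 x01 z01.
have -> : (z - y) / (z - x) * x + (1 - (z - y) / (z - x)) * z = y.
  by field; rewrite gt_eqF.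
rewrite -(ler_pM2l zx); congr (_ <= _).
by field; rewrite gt_eqF.
Qed.

Let quot k s := (G k - G s) / (k - s).

Lemma least_concave_majorant_quot_nonincr k s1 s2 : k <= 1 -> 0 <= s1 -> s1 <= s2 -> s2 < k ->
  quot k s2 <= quot k s1.
Proof.
move=> k1 s10; rewrite le_eqVlt => /predU1P[-> //|s12 s2k].
rewrite /quot ler_pdivrMr ?subr_gt0// mulrAC ler_pdivlMr ?subr_gt0 ?(lt_trans s12)//.
by have := least_concave_majorant_chord s10 s12 s2k k1; lra.
Qed.

(* A lower bound of the slopes guarantees that the limit defining [left_slope]
   exists; without it, [lim] is a junk value. *)
Lemma left_slopeP k a0 : 0 < k -> k <= 1 ->
    (forall s, 0 <= s < k -> a0 <= quot k s) ->
  [/\ forall s, 0 <= s < k -> left_slope G k <= quot k s &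
      forall a, (forall s, 0 <= s < k -> a <= quot k s) -> a <= left_slope G k].
Proof.
move=> k0 k1 lb.
have cv : cvg (quot k s @[s --> k^'-]).
  (* The quotients decrease as [s] increases to [k] and stay above [a0], so they converge to their
     infimum; both claims follow. *)
  suff : cvg ((\- quot k) s @[s --> k^'-]).
    move=> /(@is_cvgN _ R^o).
    by rewrite (_ : - _ = quot k)//; apply/funext => s /=; exact: opprK.
  apply: nondecreasing_at_left_is_cvgr.
    near=> x => u v; rewrite !in_itv/= => /andP[xu uk] /andP[xv vk] uv.
    rewrite lerN2; apply: least_concave_majorant_quot_nonincr => //.
    by apply: le_trans (ltW xu); near: x; exact: nbhs_left_ge.
  near=> x; exists (- a0) => _ [u xuk <-].
  have /andP[xu uk] : x < u < k by move: xuk; rewrite /= ?in_itv.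
  rewrite lerN2; apply: lb; rewrite uk andbT.
  by apply: le_trans (ltW xu); near: x; exact: nbhs_left_ge.
split=> [s /andP[s0 sk]|a ha].
  apply: limr_le => //; near=> u; apply: least_concave_majorant_quot_nonincr => //.
  by near: u; exact: nbhs_left_ge.
apply: limr_ge => //; near=> u; apply: ha; apply/andP; split.
  by near: u; exact: nbhs_left_ge.
by near: u; exact: nbhs_left_lt.
Unshelve. all: by end_near. Qed.

End least_concave_majorant.

Lemma exists_argmax (R : realType) (F : nat -> R) lo hi : (lo <= hi)%N ->
  exists i, (lo <= i <= hi)%N /\ forall j, (lo <= j <= hi)%N -> F j <= F i.
Proof.
move=> lohi; rewrite -(subnK lohi); elim: (hi - lo)%N => [|d [i [id Fi]]].
  by exists lo; rewrite add0n leqnn; split => // j; rewrite -eqn_leq => /eqP <-.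
have [Fle|/ltW Fge] := leP (F (d.+1 + lo)%N) (F i).
  exists i; split => [|j]; first by lia.
  case: (eqVneq j (d.+1 + lo)%N) => [-> //|jn /andP[lj jd]].
  by apply: Fi; lia.
exists (d.+1 + lo)%N; split => [|j]; first by lia.
case: (eqVneq j (d.+1 + lo)%N) => [-> //|jn /andP[lj jd]].
by apply: le_trans Fge; apply: Fi; lia.
Qed.

Section knots.
Context (R : realType) (n : nat) (S : nat -> R) (g : R -> R).
Hypothesis n_gt0 : (0 < n)%N.
Hypothesis gS : forall i, (i <= n)%N -> g (i%:R / n%:R) = S i.
(** Piecewise linearity is used only in this form. *)
Hypothesis g_le_line : forall a b : R,
  (forall i, (i <= n)%N -> S i <= a * (i%:R / n%:R) + b) ->
  forall t, 0 <= t <= 1 -> g t <= a * t + b.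
Let G := least_concave_majorant g.
Let x (i : nat) : R := i%:R / n%:R.
(** Knot values tilted by [a]: where [W a] is maximal, the line of slope [a] through the knot
    supports the majorant. The left slope at knot [k] is compared with [a] by locating this maximum
    on either side of [k]. *)
Let W a (i : nat) : R := S i - a * x i.

Let n0 : 0 < n%:R :> R. Proof. by rewrite ltr0n. Qed.

Let x_itv i : (i <= n)%N -> 0 <= x i <= 1.
Proof. by move=> ni; rewrite /x divr_ge0//= ler_pdivrMr// mul1r ler_nat. Qed.

Let xlt i j : (i < j)%N -> x i < x j.
Proof. by move=> ij; rewrite ltr_pM2r ?invr_gt0// ltr_nat. Qed.

Let xle i j : (i <= j)%N -> x i <= x j.
Proof. by move=> ij; rewrite ler_pM2r ?invr_gt0// ler_nat. Qed.

Let g_bounded : exists M, forall t, 0 <= t <= 1 -> g t <= M.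
Proof.
have [i [_ Si]] := exists_argmax S (leq0n n).
exists (S i) => t t01; rewrite -[S i]add0r -(mul0r t).
by apply: g_le_line => // j jn; rewrite mul0r add0r; exact: Si.
Qed.

Let G_le_line a b t : (forall i, (i <= n)%N -> S i <= a * x i + b) ->
  0 <= t <= 1 -> G t <= a * t + b.
Proof.
move=> Sab t01; apply: (least_concave_majorant_le (h := fun t => a * t + b)) => //; last exact: g_le_line.
by apply/concave_onP => u y z *; lra.
Qed.

Let S_le_G i : (i <= n)%N -> S i <= G (x i).
Proof.
move=> ni; have [M gM] := g_bounded.
by rewrite -gS//; apply: (least_concave_majorant_ge gM); exact: x_itv.
Qed.

(** The line of slope [a] through knot [i] lies above [G] and meets it at [x i], so chords of [G]
    ending at [x i] have slope at least [a]. By concavity, moving the right end back to [x k] only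
    increases the slope. *)
Let quot_ge_of_argmax a k i : (k <= i <= n)%N ->
    (forall j, (j <= n)%N -> W a j <= W a i) ->
  forall s, 0 <= s < x k -> a <= (G (x k) - G s) / (x k - s).
Proof.
move=> /andP[ki ni] Wi s /andP[s0 sk]; have [M gM] := g_bounded.
have line t : 0 <= t <= 1 -> G t <= a * t + W a i.
  apply: G_le_line => j jn; have := Wi _ jn; rewrite /W; lra.
have Gi : a * x i + W a i <= G (x i) by apply: le_trans (S_le_G ni); rewrite /W; lra.
have /andP[_ xi1] := x_itv ni.
have s01 : 0 <= s <= 1 by rewrite s0 (le_trans (ltW sk))// (le_trans _ xi1)// xle.
rewrite ler_pdivlMr ?subr_gt0//.
have ls := line s s01.
have [ik|ki'] := eqVneq i k; first by rewrite -ik; lra.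
have ik : x k < x i by apply: xlt; rewrite ltn_neqAle eq_sym ki'.
have ch := least_concave_majorant_chord gM s0 sk ik xi1.
suff : (x i - s) * (a * (x k - s)) <= (x i - s) * (G (x k) - G s).
  by rewrite ler_pM2l// subr_gt0 (lt_trans sk).
have : (x k - s) * (a * x i + W a i - G s) <= (x i - s) * (G (x k) - G s).
  apply: (@le_trans _ _ ((x k - s) * (G (x i) - G s))); last by rewrite -/G in ch; lra.
  by rewrite ler_pM2l ?subr_gt0//; lra.
apply: le_trans.
have : 0 <= (x k - s) * (a * s + W a i - G s) by apply: mulr_ge0; lra.
by lra.
Qed.

Let knot_slope k (kn : (0 < k <= n)%N) :
  [/\ forall s, 0 <= s < x k ->
        left_slope G (x k) <= (G (x k) - G s) / (x k - s) &
      forall a, (forall s, 0 <= s < x k -> a <= (G (x k) - G s) / (x k - s)) ->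
        a <= left_slope G (x k)].
Proof.
have [M gM] := g_bounded; move: kn => /andP[k0 kn].
have xk0 : 0 < x k by rewrite divr_gt0// ltr0n.
have /andP[_ xk1] := x_itv kn.
(* Knots are at least 1 / n apart and [D] dominates each [S n - S j] in absolute value; tilted by
   the slope [- n D], the knot values are maximal at [n]. *)
pose D := \sum_(j < n.+1) `|S n - S j|.
apply: (left_slopeP gM xk0 xk1 (a0 := - (n%:R * D))).
apply: (quot_ge_of_argmax (i := n)); first by rewrite kn leqnn.
move=> j; rewrite leq_eqVlt => /predU1P[-> //|jn].
have Dj : `|S n - S j| <= D.
  rewrite /D (bigD1 (inord j)) //= inordK ?lerDl; last by rewrite ltnS ltnW.
  by apply: sumr_ge0 => *; exact: normr_ge0.
have D0 : 0 <= D by exact: le_trans (normr_ge0 _) Dj.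
have xj : 1 <= n%:R * (x n - x j).
  rewrite /x -mulrBl mulrCA divff ?gt_eqF// mulr1 -natrB 1?ltnW//.
  by rewrite ler1n subn_gt0.
have : D * 1 <= D * (n%:R * (x n - x j)) by exact: ler_wpM2l.
have := ler_norm (- (S n - S j)); rewrite normrN /W; lra.
Qed.

(** Take [i >= k] maximizing the slope [a1] from knot [j]. If [a1 < a], no knot from [k] on has a
    larger [W a1] than [j], so [W a1] is maximal at some [h < k]. The supporting line there forces
    [G] to have slope at most [a1] between [x h] and [x k], a contradiction. *)
Lemma knot_left_slope_ge k a : (0 < k <= n)%N -> a <= left_slope G (x k) ->
  forall j, (j < k)%N -> exists2 i, (k <= i <= n)%N &
    a * (x i - x j) <= S i - S j.
Proof.
move=> /[dup] kn /andP[k0 kn'] aL j jk.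
have [i [/andP[ki ni] Fi]] :=
  exists_argmax (fun i => (S i - S j) / (x i - x j)) kn'.
exists i; first by rewrite ki.
have ji : x j < x i by apply: xlt; exact: leq_trans ki.
rewrite -ler_pdivlMr ?subr_gt0//; set a1 := _ / _.
rewrite leNgt; apply/negP => a1a.
have [h [/andP[_ hk] Wh]] := exists_argmax (W a1) (leq0n k.-1).
have {}hk : (h < k)%N by lia.
have glob l : (l <= n)%N -> W a1 l <= W a1 h.
  move=> ln; have [lk|kl] := ltnP l k; first by apply: Wh; lia.
  apply: (@le_trans _ _ (W a1 j)); last by apply: Wh; lia.
  have := Fi l; rewrite kl ln => /(_ isT).
  have jl : x j < x l by apply: xlt; exact: leq_trans kl.
  by rewrite ler_pdivrMr ?subr_gt0// -/a1 /W; lra.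
have hk' := xlt hk.
have /andP[xh0 _] : 0 <= x h <= 1 by apply: x_itv; lia.
have [+ _] := knot_slope kn => /(_ (x h)); rewrite xh0 hk' => /(_ isT).
rewrite ler_pdivlMr ?subr_gt0//.
have Gk : G (x k) <= a1 * x k + W a1 h.
  by apply: G_le_line => [l ln|]; [have := glob _ ln; rewrite /W; lra|exact: x_itv].
have Gh : a1 * x h + W a1 h <= G (x h).
  by apply: le_trans (S_le_G _); [rewrite /W; lra|lia].
have : 0 < x k - x h by rewrite subr_gt0.
by move: aL a1a; nra.
Qed.

(** If some [i >= k] sees slopes at least [a] from every [j < k], then [W a] attains its overall
    maximum at an index not below [k], and the left slope at [k] is at least [a]. *)
Lemma knot_left_slope_lt k a : (0 < k <= n)%N -> left_slope G (x k) < a ->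
  forall i, (k <= i <= n)%N -> exists2 j, (j < k)%N &
    S i - S j < a * (x i - x j).
Proof.
move=> /[dup] kn /andP[k0 kn'] aL i /andP[ki ni].
apply: contrapT => nex; move: aL; rewrite ltNge => /negP; apply.
have [h [/andP[kh nh] Wh]] := exists_argmax (W a) kn'.
apply: (knot_slope kn).2; apply: (quot_ge_of_argmax (i := h)); first by rewrite kh.
move=> l ln; have [lk|kl] := ltnP l k; last by apply: Wh; rewrite kl.
apply: (@le_trans _ _ (W a i)); last by apply: Wh; rewrite ki.
rewrite leNgt; apply/negP => Wil; apply: nex; exists l => //.
by move: Wil; rewrite /W; lra.
Qed.

End knots.

(** * Max-min bounds for the estimator *)

Section piecewise_linear.
Context (R : realType) (s : seq (R * R)).
Let n := size s.
Hypothesis n_gt0 : (0 < n)%N.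
Let n0 : 0 < n%:R :> R. Proof. by rewrite ltr0n. Qed.

Lemma Lambda_at_knot i : (i <= n)%N -> Lambda s (i%:R / n%:R) = Lambda_knot s i.
Proof.
move=> ni; rewrite /Lambda -/n mulrCA divff ?gt_eqF// mulr1 natrK.
by rewrite subrr mul0r addr0.
Qed.

Lemma Lambda_le_line (a b : R) :
    (forall i, (i <= n)%N -> Lambda_knot s i <= a * (i%:R / n%:R) + b) ->
  forall t, 0 <= t <= 1 -> Lambda s t <= a * t + b.
Proof.
move=> Sab t /andP[t0 t1]; rewrite /Lambda -/n.
set i := Num.truncn _.
have nt0 : 0 <= n%:R * t by rewrite mulr_ge0// ltW.
have /andP[it ti] := truncn_itv nt0; rewrite -/i in it ti.
have tE : t = n%:R * t / n%:R by rewrite mulrAC divff ?gt_eqF// mul1r.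
have ile : (i <= n)%N by rewrite -(ler_nat R); apply: le_trans it _; rewrite -[leRHS]mulr1 ler_pM2l.
rewrite [in X in _ <= X]tE; set u := n%:R * t in it ti *.
(* At [t = 1] the right neighbour is the knot [n + 1], about which nothing is assumed; its weight is
   0. *)
have [in_|in_] := eqVneq i n.
  have -> : u = i%:R.
    by apply/eqP; rewrite eq_le it andbT in_ /u -[leRHS]mulr1 ler_pM2l.
  by rewrite subrr mul0r addr0; exact: Sab.
have := Sab i ile; have := Sab i.+1; rewrite ltn_neqAle in_ ile => /(_ isT).
rewrite -natr1; set A := Lambda_knot s i.+1; set B := Lambda_knot s i.
set j := i%:R in it ti *; move=> HA HB.
have : (u - j) * A <= (u - j) * (a * ((j + 1) / n%:R) + b).
  by apply: ler_wpM2l => //; rewrite subr_ge0.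
have : (1 - (u - j)) * B <= (1 - (u - j)) * (a * (j / n%:R) + b).
  by apply: ler_wpM2l => //; rewrite -natr1 in ti; rewrite -/j in ti; lra.
by set c := n%:R^-1; lra.
Qed.

End piecewise_linear.

Section estimator.
Context (R : realType) (n : nat) (z : 'I_n -> R * R).
Let s := [seq z i | i : 'I_n].
Let X (l : 'I_n) := (z l).1.
Let leX : rel 'I_n := relpre z (fun u v => u.1 <= v.1).
(** Sorting indices instead of pairs turns blocks of ranks into index sets of the original
    independent sample. *)
Let e := sort leX (enum 'I_n).

Let size_s : size s = n. Proof. by rewrite size_map size_enum_ord. Qed.

Let size_e : size e = n. Proof. by rewrite size_sort size_enum_ord. Qed.

Let order_sampleE : order_sample s = map z e.
Proof. by rewrite /order_sample /s sort_map. Qed.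

Let leX_total : total leX. Proof. by move=> u v; exact: le_total. Qed.

Let leX_trans : transitive leX.
Proof. by move=> u v w; exact: le_trans. Qed.

Let mem_e l : l \in e. Proof. by rewrite mem_sort mem_enum. Qed.

Let uniq_e : uniq e. Proof. by rewrite sort_uniq enum_uniq. Qed.

Let index_lt l : (index l e < n)%N. Proof. by rewrite -[ltnRHS]size_e index_mem. Qed.

Let le_index l1 l2 : (index l1 e <= index l2 e)%N -> X l1 <= X l2.
Proof.
move=> l12; have leX_refl : reflexive leX by move=> u; exact: lexx.
exact: (sorted_leq_index leX_trans leX_refl (sort_sorted leX_total (enum 'I_n))).
Qed.

(** An upward closed predicate holds on a final segment of the ranks, which starts at [find]. *)
Let find_le_index (p : pred R) l : {homo p : x y / x <= y >-> x ==> y} ->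
  (find (fun u : R * R => p u.1) (order_sample s) <= index l e)%N = p (X l).
Proof.
move=> homp; rewrite order_sampleE find_map; set q := preim _ _.
apply/idP/idP => [fl|pl].
  have fe : (find q e < size e)%N by rewrite size_e (leq_ltn_trans fl).
  have : has q e by rewrite has_find.
  move=> /(nth_find l); rewrite /q /=; set l' := nth _ _ _ => pl'.
  apply: (implyP (homp _ _ _) pl'); apply: le_index.
  by rewrite index_uniq.
rewrite leqNgt; apply/negP => /(before_find l).
by rewrite /q /= nth_index// pl.
Qed.

Let find_ge_index (t : R) l :
  (find (fun u : R * R => t <= u.1)%R (order_sample s) <= index l e)%N = (t <= X l).
Proof.
by apply: (find_le_index (p := fun x => t <= x)) => x y xy /=; apply/implyP => /le_trans; apply.
Qed.

Let find_gt_index (t : R) l :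
  (find (fun u : R * R => t < u.1)%R (order_sample s) <= index l e)%N = (t < X l).
Proof.
by apply: (find_le_index (p := fun x => t < x)) => x y xy /=; apply/implyP => /lt_le_trans; apply.
Qed.

Let block i j : {set 'I_n} := [set l : 'I_n | (j <= index l e < i)%N]%SET.

Let Lambda_knotB a i j : (j <= i <= n)%N -> (0 < n)%N ->
  Lambda_knot s i - Lambda_knot s j - a * (i%:R / n%:R - j%:R / n%:R) =
  (\sum_(l in block i j) ((z l).2 - a)) / n%:R.
Proof.
move=> /andP[ji in_] n0; have nneq0 : n%:R != 0 :> R by rewrite pnatr_eq0 -lt0n.
rewrite /Lambda_knot size_s.
rewrite -!(big_mkord predT (fun q => (nth (0, 0) (order_sample s) q).2)).
rewrite (big_cat_nat (n := j) (p := i))//=.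
have -> : \sum_(l in block i j) ((z l).2 - a) =
    \sum_(j <= q < i) (nth (0, 0) (order_sample s) q).2 - a * (i%:R - j%:R).
  have -> : a * (i%:R - j%:R) = \sum_(j <= q < i) a.
    by rewrite big_const_nat iter_addr_0 -natrB// mulr_natr.
  rewrite -sumrB; under eq_bigl do rewrite inE.
  rewrite (perm_big e)/=; last first.
    apply: uniq_perm => //; first exact: index_enum_uniq.
    by move=> l; rewrite mem_index_enum mem_e.
  rewrite (big_nth (Ordinal n0)) size_e (big_nat_widen j i n)//.
  rewrite (big_nat_widenl j 0)//= 2![RHS]big_nat_cond 1![LHS]big_nat_cond.
  apply: eq_big => q; last first.
    move=> /andP[/andP[_ qn] _]; rewrite order_sampleE (nth_map (Ordinal n0))//.
    by rewrite size_e.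
  case: (ltnP q n) => qn; last by rewrite andbF.
  by rewrite index_uniq ?size_e// andbC [in RHS]andbC; case: (j <= q)%N; rewrite /= ?andbT ?andbF.
by field.
Qed.

Let lambda_hatE k : (0 < k)%N -> (0 < n)%N ->
  lambda_hat s (k%:R / n%:R) =
  left_slope (least_concave_majorant (Lambda s)) (k%:R / n%:R).
Proof.
move=> k0 n0; rewrite /lambda_hat mulf_eq0 invr_eq0 !pnatr_eq0.
by rewrite !gtn_eqF.
Qed.

Let lambda_hat_ge k a : (0 < k <= n)%N -> a <= lambda_hat s (k%:R / n%:R) ->
  forall j, (j < k)%N -> exists2 i, (k <= i <= n)%N &
    0 <= \sum_(l in block i j) ((z l).2 - a).
Proof.
move=> /[dup] kn /andP[k0 kn']; have n0 := leq_trans k0 kn'.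
have s0 : (0 < size s)%N by rewrite size_s.
rewrite lambda_hatE// -{1 2}size_s => ka j jk.
have [|i kin] := knot_left_slope_ge s0 (Lambda_at_knot s0) (Lambda_le_line s0) _ ka jk.
  by rewrite size_s.
rewrite size_s in kin * => Sij; exists i => //.
move: Sij; rewrite -subr_ge0 Lambda_knotB//; last by lia.
by rewrite pmulr_lge0// invr_gt0 ltr0n.
Qed.

Let lambda_hat_lt k a : (0 < k <= n)%N -> lambda_hat s (k%:R / n%:R) < a ->
  forall i, (k <= i <= n)%N -> exists2 j, (j < k)%N &
    \sum_(l in block i j) ((z l).2 - a) < 0.
Proof.
move=> /[dup] kn /andP[k0 kn']; have n0 := leq_trans k0 kn'.
have s0 : (0 < size s)%N by rewrite size_s.
rewrite lambda_hatE// -{1}size_s => ka i kin.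
have [||j jk] := knot_left_slope_lt s0 (Lambda_at_knot s0) (Lambda_le_line s0) _ ka (i := i).
- by rewrite size_s.
- by rewrite size_s.
rewrite size_s => Sij; exists j => //.
move: Sij; rewrite -subr_lt0 Lambda_knotB//; last by lia.
by rewrite pmulr_llt0// invr_gt0 ltr0n.
Qed.

(* Between the samples with abscissa in [[t0, v[] and those in [[t0, v]], the set [A]
   leaves room for an arbitrary part of the ties at [v]. *)
Lemma mu_hat_ge (t0 t a : R) l0 : a <= mu_hat s t -> t0 <= t -> t0 <= X l0 ->
  exists v (A : {set 'I_n}), [/\ t <= v, forall l, t0 <= X l < v -> l \in A,
    {in A, forall l, t0 <= X l <= v} & 0 <= \sum_(l in A) ((z l).2 - a)].
Proof.
have n0 : (0 < n)%N := leq_ltn_trans (leq0n _) (ltn_ord l0).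
rewrite /mu_hat; set i0 := find _ _; rewrite size_s => amu t0t Xl0.
have i0n : (i0 <= n)%N by rewrite -size_s -(size_sort (fun u v : R * R => u.1 <= v.1)) find_size.
set k := minn i0.+1 n in amu.
have kn : (0 < k <= n)%N by rewrite /k; lia.
pose j := find (fun u : R * R => t0 <= u.1) (order_sample s).
have jl0 : (j <= index l0 e)%N by rewrite find_ge_index.
have ji0 : (j <= i0)%N.
  by rewrite /j /i0; apply: sub_find => u /=; exact: le_trans.
have jk : (j < k)%N by rewrite /k; have := index_lt l0; lia.
have [i /andP[ki in_] sum_ge0] := lambda_hat_ge kn amu jk.
have ie : (i.-1 < size e)%N by rewrite size_e; lia.
pose li := nth l0 e i.-1; have indexli : index li e = i.-1 by rewrite index_uniq.
(* Since [k <= i], the block contains every sample in [[t0], [t][ even if its last abscissa lies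
   before [t]; hence the maximum. *)
exists (Num.max t (X li)), (block i j); split => //.
- by rewrite le_max lexx.
- move=> l /andP[t0l]; rewrite lt_max inE find_ge_index t0l/=.
  move=> /orP[lt|]; last first.
    by rewrite ltNge; apply: contraNltn => il; apply: le_index; rewrite indexli; lia.
  have : (index l e < i0)%N by rewrite ltnNge find_ge_index -ltNge.
  by rewrite /k in ki; have := index_lt l; lia.
- move=> l; rewrite inE find_ge_index => /andP[-> li_]/=.
  by rewrite le_max; apply/orP; right; apply: le_index; rewrite indexli; lia.
Qed.

(** Not an exact mirror of the previous lemma: the value at [t] belongs to the first sample at or
    after [t], so the block may start to the right of [t]. The sample [l0] keeps its start below
    [t']. *)
Lemma mu_hat_lt (t t' t1 a : R) l0 : mu_hat s t < a -> t <= X l0 <= t' -> t' <= t1 ->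
  exists v (A : {set 'I_n}), [/\ v <= t', forall l, v < X l <= t1 -> l \in A,
    {in A, forall l, v <= X l <= t1} & \sum_(l in A) ((z l).2 - a) < 0].
Proof.
have n0 : (0 < n)%N := leq_ltn_trans (leq0n _) (ltn_ord l0).
rewrite /mu_hat; set i0 := find _ _; rewrite size_s => amu /andP[tl0 l0t'] t't1.
have i0l0 : (i0 <= index l0 e)%N by rewrite find_ge_index.
set k := minn i0.+1 n in amu.
pose i := find (fun u : R * R => t1 < u.1) (order_sample s).
have l0i : (index l0 e < i)%N.
  by rewrite ltnNge find_gt_index -leNgt (le_trans l0t').
have in_ : (i <= n)%N by rewrite -size_s -(size_sort (fun u v : R * R => u.1 <= v.1)) find_size.
have kn : (0 < k <= n)%N by rewrite /k; lia.
have kin : (k <= i <= n)%N by rewrite /k; lia.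
have [j jk sum_lt0] := lambda_hat_lt kn amu kin.
have je : (j < size e)%N by rewrite size_e; lia.
pose lj := nth l0 e j; have indexlj : index lj e = j by rewrite index_uniq.
exists (X lj), (block i j); split => //.
- by apply: le_trans l0t'; apply: le_index; rewrite indexlj /k in jk *; lia.
- move=> l /andP[jl lt1]; rewrite inE [(_ < i)%N]ltnNge find_gt_index -leNgt lt1 andbT.
  by rewrite leqNgt; apply: contraTN jl => /ltnW lj_; rewrite -leNgt le_index// indexlj.
- move=> l; rewrite inE [(_ < i)%N]ltnNge find_gt_index -leNgt => /andP[jl ->].
  by rewrite andbT le_index// indexlj.
Qed.

(** Crude bound by the largest response, for deviations beyond every scale of the drift. Choosing
    [j = k - 1] makes the block nonempty; an empty block has sum 0, which would satisfy the
    inequality vacuously. *)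
Lemma mu_hat_ge_exists (t a : R) : (0 < n)%N -> a <= mu_hat s t ->
  exists l, a <= (z l).2.
Proof.
move=> n0; rewrite /mu_hat; set k := minn _ _; rewrite size_s => amu.
have kn : (0 < k <= n)%N by rewrite /k size_s; lia.
have [i /andP[ki in_]] := lambda_hat_ge kn amu (j := k.-1) ltac:(lia).
apply: contraPP => nex; apply/negP; rewrite -ltNge.
pose l0 := nth (Ordinal n0) e k.-1.
have indexl0 : index l0 e = k.-1 by rewrite index_uniq// size_e; lia.
have neg l : (z l).2 - a < 0.
  by rewrite subr_lt0 ltNge; apply/negP => al; apply: nex; exists l.
rewrite (bigD1 l0)/=; last by rewrite inE indexl0; lia.
by rewrite ltr_wnDr//; apply: sumr_le0 => l _; exact: ltW.
Qed.

Lemma mu_hat_lt_exists (t a : R) : (0 < n)%N -> mu_hat s t < a ->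
  exists l, (z l).2 < a.
Proof.
move=> n0; rewrite /mu_hat; set k := minn _ _; rewrite size_s => amu.
have kn : (0 < k <= n)%N by rewrite /k size_s; lia.
have [j jk] := lambda_hat_lt kn amu (i := k) ltac:(lia).
apply: contraPP => nex; apply/negP; rewrite -leNgt.
apply: sumr_ge0 => l _; rewrite subr_ge0 leNgt; apply/negP => al.
by apply: nex; exists l.
Qed.

End estimator.

(** * The regression function and its generalized inverse *)

Section bi_Lipschitz.
Context (R : realType) (mu mu' : R -> R) (A1 A2 : R).
Hypothesis mu_noninc : {in `[0, 1] &, {homo mu : x y /~ x <= y}}.
Hypothesis dmu : forall t, t \in `[0, 1] -> has_derivative_within `[0, 1] mu t (mu' t).
Hypothesis mu'_bounds : forall t, t \in `[0, 1] -> A1 < `|mu' t| < A2.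

Let near_quot (t e : R) : 0 <= t <= 1 -> 0 < e -> exists2 r, 0 < r &
  forall s, 0 <= s <= 1 -> s != t -> `|s - t| < r ->
    `|mu' t - (mu s - mu t) / (s - t)| < e.
Proof.
move=> t01 e0; have := dmu t01 => /cvgrPdist_lt/(_ _ e0).
rewrite near_withinE near_withinE => -[r /= r0 Hr].
exists r => // s s01 st str; apply: Hr => //=.
by rewrite /ball/= distrC.
Qed.

Let is_derive_mu (t : R) : 0 < t < 1 -> is_derive t 1 mu (mu' t).
Proof.
move=> /andP[t0 t1]; have t01 : 0 <= t <= 1 by lra.
suff cv : h^-1 *: (mu (h *: 1 + t) - mu t) @[h --> 0^'] --> mu' t.
  by apply: DeriveDef; [apply/cvg_ex; exists (mu' t)|exact: cvg_lim].
apply/cvgrPdist_lt => e e0; have [r r0 Hr] := near_quot t01 e0.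
near=> h; have h0 : h != 0 by near: h; exact: nbhs_dnbhs_neq.
have hr : `|h| < Num.min r (Num.min t (1 - t)).
  near: h; apply: dnbhs0_lt; rewrite !lt_min r0 t0/=; lra.
move: hr; rewrite !lt_min => /and3P[hr ht h1t].
have := ler_norm h; have := ler_norm (- h); rewrite normrN => hn1 hn2.
have := Hr (h + t); rewrite -subr_eq0 addrK; rewrite /GRing.scale/= mulr1 mulrC.
by apply => //; apply/andP; split; lra.
Unshelve. all: by end_near. Qed.

Let continuous_mu (x y : R) : 0 <= x -> y <= 1 -> {within `[x, y], continuous mu}.
Proof.
move=> x0 y1; apply/subspace_continuousP => t; rewrite /= in_itv/= => /andP[xt ty].
have t01 : 0 <= t <= 1 by lra.
apply/cvgrPdist_lt => e e0; have [r r0 Hr] := near_quot t01 (@ltr01 R).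
have L0 : 0 < `|mu' t| + 1 by rewrite ltr_wpDl.
rewrite near_withinE; near=> s => /=; rewrite in_itv/= => /andP[xs sy].
have [->|st] := eqVneq s t; first by rewrite subrr normr0.
have str : `|s - t| < r.
  by rewrite distrC; near: s; exact: nbhs_ball_norm (PosNum r0).
have ste : `|s - t| < e / (`|mu' t| + 1).
  rewrite distrC; near: s; have eL : 0 < e / (`|mu' t| + 1) by rewrite divr_gt0.
  exact: nbhs_ball_norm (PosNum eL).
have st0 : 0 < `|s - t| by rewrite normr_gt0 subr_eq0.
have s01 : 0 <= s <= 1 by lra.
have q1 := Hr s s01 st str.
have -> : mu t - mu s = - ((mu s - mu t) / (s - t) * (s - t)).
  by rewrite divfK ?subr_eq0// opprB.
rewrite normrN normrM; rewrite ltr_pdivlMr// mulrC in ste; apply: le_lt_trans ste.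
apply: ler_wpM2r; first exact: ltW.
have := ler_distD (mu' t) ((mu s - mu t) / (s - t)) 0; rewrite !subr0 distrC => h.
by apply: le_trans h _; rewrite addrC lerD2l ltW.
Unshelve. all: by end_near. Qed.

(** Mean value theorem, with the sign of [mu'] fixed by monotonicity. The one-sided derivatives at 0
    and 1 enter only through continuity up to the ends. *)
Lemma bi_Lipschitz x y : 0 <= x -> x <= y -> y <= 1 ->
  A1 * (y - x) <= mu x - mu y <= A2 * (y - x).
Proof.
move=> x0; rewrite le_eqVlt => /predU1P[<-|xy] y1; first by rewrite !subrr !mulr0 lexx.
have der t : t \in `]x, y[ -> is_derive t 1 mu (mu' t).
  by rewrite in_itv/= => /andP[xt ty]; apply: is_derive_mu; lra.
have [t] := MVT xy der (continuous_mu x0 y1).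
rewrite in_itv/= => /andP[xt ty] E.
have t01 : t \in `[0, 1] by rewrite in_itv/=; lra.
have xy0 : 0 < y - x by rewrite subr_gt0.
have le0 : mu y - mu x <= 0.
  by rewrite subr_le0; apply: mu_noninc; rewrite ?in_itv/= ?(ltW xy)//; apply/andP; split; lra.
have mu'0 : mu' t <= 0 by rewrite -(pmulr_lle0 _ xy0) -E.
have -> : mu x - mu y = - mu' t * (y - x) by rewrite mulNr -E opprB.
have /andP[/ltW h1 /ltW h2] := mu'_bounds t01; rewrite ler0_norm// in h1 h2.
by apply/andP; split; apply: ler_wpM2r => //; exact: ltW.
Qed.

End bi_Lipschitz.

Section generalized_inverse.
Context (R : realType) (h : R -> R) (a : R).
Let G := [set t | t \in `[0, 1] /\ a <= h t].

Let G_ub : ubound G 1.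
Proof. by move=> t [+ _]; rewrite in_itv/= => /andP[]. Qed.

Lemma generalized_inverse_itv : 0 <= generalized_inverse h a <= 1.
Proof.
rewrite /generalized_inverse -/G; have [->|/set0P[t Gt]] := eqVneq G set0.
  by rewrite sup0 lexx ler01.
apply/andP; split.
  apply: (@le_trans _ _ t); last by apply: ub_le_sup => //; exists 1.
  by case: Gt; rewrite in_itv/= => /andP[].
by apply: ge_sup => //; exists t.
Qed.

Lemma le_generalized_inverse t : 0 <= t <= 1 -> a <= h t ->
  t <= generalized_inverse h a.
Proof.
by move=> t01 aht; apply: ub_le_sup; [exists 1|split => //; rewrite in_itv].
Qed.

Lemma generalized_inverse_le t : 0 <= t ->
  (forall u, t < u <= 1 -> h u < a) -> generalized_inverse h a <= t.
Proof.
move=> t0 hu; rewrite /generalized_inverse -/G.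
have [->|/set0P[u Gu]] := eqVneq G set0; first by rewrite sup0.
apply: ge_sup; first by exists u.
move=> v [+ ahv]; rewrite in_itv/= => /andP[_ v1]; rewrite leNgt; apply/negP => tv.
by move: ahv; rewrite leNgt hu// tv.
Qed.

Variable L : R.
Hypothesis h_Lip : forall x y, 0 <= x -> x <= y -> y <= 1 ->
  0 <= h x - h y <= L * (y - x).
Let t0 := generalized_inverse h a.

(** Points to the right of [t0] are below the level, hence so is [t0] by continuity. At [t0 = 1] the
    value may exceed [a]; symmetrically, the next lemma excludes [t0 = 0], which is also the default
    value for the empty set. *)
Lemma generalized_inverse_value_le : t0 < 1 -> h t0 <= a.
Proof.
move=> t01; have /andP[t0_0 _] := generalized_inverse_itv; rewrite -/t0 in t0_0.
apply/ler_addgt0Pr => e e0; pose r := Num.min (1 - t0) (e / (`|L| + 1)).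
have L0 : 0 < `|L| + 1 by rewrite ltr_wpDl.
have r0 : 0 < r by rewrite lt_min subr_gt0 t01 divr_gt0.
have r1 : r <= 1 - t0 by rewrite ge_min lexx.
have rL : `|L| * r <= e.
  apply: (@le_trans _ _ ((`|L| + 1) * r)); first by rewrite ler_pM2r// lerDl.
  by rewrite mulrC -ler_pdivlMr// ge_min lexx orbT.
have hlt : h (t0 + r) < a.
  rewrite ltNge; apply/negP => ah.
  have t0r : 0 <= t0 + r <= 1 by lra.
  by have := le_generalized_inverse t0r ah; rewrite -/t0; lra.
have /andP[_] := h_Lip t0_0 (ltac:(lra) : t0 <= t0 + r) ltac:(lra).
rewrite (_ : t0 + r - t0 = r); last by ring.
have := ler_norm L; nra.
Qed.

Lemma generalized_inverse_value_ge : 0 < t0 -> a <= h t0.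
Proof.
move=> t00; have /andP[_ t01] := generalized_inverse_itv; rewrite -/t0 in t01.
apply/ler_addgt0Pr => e e0; pose r := Num.min t0 (e / (`|L| + 1)).
have L0 : 0 < `|L| + 1 by rewrite ltr_wpDl.
have r0 : 0 < r by rewrite lt_min t00 divr_gt0.
have r1 : r <= t0 by rewrite ge_min lexx.
have rL : `|L| * r <= e.
  apply: (@le_trans _ _ ((`|L| + 1) * r)); first by rewrite ler_pM2r// lerDl.
  by rewrite mulrC -ler_pdivlMr// ge_min lexx orbT.
have hge : a <= h (t0 - r).
  rewrite leNgt; apply/negP => hlt.
  have : t0 <= t0 - r; last by lra.
  apply: generalized_inverse_le => [|u /andP[u1 u2]]; first by lra.
  have /andP[+ _] := h_Lip (ltac:(lra) : 0 <= t0 - r) (ltW u1) u2.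
  by rewrite subr_ge0 => /le_lt_trans; apply.
have /andP[_] := h_Lip (ltac:(lra) : 0 <= t0 - r) (ltac:(lra) : t0 - r <= t0) t01.
rewrite (_ : t0 - (t0 - r) = r); last by ring.
have := ler_norm L; nra.
Qed.

End generalized_inverse.

(** * Product formula, Chernoff bound and moments from tails *)

Section product_rule.
Local Open Scope ereal_scope.
Context d d' (T : measurableType d) (S : measurableType d') (R : realType).
Variables (mu : {measure set T -> \bar R}) (U : T -> R) (Z : T -> S).
Hypotheses (mU : measurable_fun setT U) (U0 : forall t, (0 <= U t)%R).
Hypothesis mZ : measurable_fun setT Z.

Import HBNNSimple.

(** From indicators to simple functions by linearity, then to [G] by monotone convergence. In the
    application [U] is the product of the other independent factors. *)
Lemma ge0_integralM_comp (c : \bar R) (G : S -> R) : 0 <= c -> c \is a fin_num ->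
    (forall B, measurable B ->
      \int[mu]_t (U t * \1_B (Z t))%:E = c * \int[mu]_t (\1_B (Z t))%:E) ->
    measurable_fun setT G -> (forall s, (0 <= G s)%R) ->
  \int[mu]_t (U t * G (Z t))%:E = c * \int[mu]_t (G (Z t))%:E.
Proof.
move=> c0 cfin UindicE mG G0.
have mEG : measurable_fun setT (EFin \o G) by exact/measurable_EFinP.
pose G_ := nnsfun_approx measurableT mEG.
have mGZ n : measurable_fun setT (fun t => G_ n (Z t)) by exact: measurableT_comp.
have mUGZ n : measurable_fun setT (fun t => U t * G_ n (Z t))%R.
  exact: measurable_funM.
have GZ s : (G_ n s)%:E @[n --> \oo] --> (G s)%:E.
  by apply: (cvg_nnsfun_approx _ mEG) => // x _; rewrite lee_fin.
have ndG s m n : (m <= n)%N -> (G_ m s <= G_ n s)%R.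
  by move=> mn; exact/lefP/nd_nnsfun_approx.
have lim1 : \int[mu]_t (G_ n (Z t))%:E @[n --> \oo] --> \int[mu]_t (G (Z t))%:E.
  rewrite [X in _ --> X](_ : _ = \int[mu]_t limn (fun n => (G_ n (Z t))%:E)).
    apply: cvg_monotone_convergence => //.
    - by move=> n; exact/measurable_EFinP.
    - by move=> n t _; rewrite lee_fin.
    - by move=> t _ m n mn; rewrite lee_fin; exact: ndG.
  by apply: eq_integral => t _; apply/esym/cvg_lim.
have lim2 : \int[mu]_t (U t * G_ n (Z t))%:E @[n --> \oo] -->
    \int[mu]_t (U t * G (Z t))%:E.
  rewrite [X in _ --> X](_ : _ = \int[mu]_t limn (fun n => (U t * G_ n (Z t))%:E)).
    apply: cvg_monotone_convergence => //.
    - by move=> n; exact/measurable_EFinP.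
    - by move=> n t _; rewrite lee_fin mulr_ge0.
    - by move=> t _ m n mn; rewrite lee_fin ler_wpM2l//; exact: ndG.
  apply: eq_integral => t _; apply/esym/cvg_lim => //.
  rewrite EFinM; under eq_fun do rewrite EFinM.
  by apply: cvgeZl => //; exact: GZ.
suff stepE n : \int[mu]_t (U t * G_ n (Z t))%:E = c * \int[mu]_t (G_ n (Z t))%:E.
  have -> : \int[mu]_t (U t * G (Z t))%:E = limn (fun n => c * \int[mu]_t (G_ n (Z t))%:E).
    by apply/esym/cvg_lim => //; under eq_fun do rewrite -stepE.
  rewrite limeMl//; last by apply/cvg_ex; eexists; exact: lim1.
  by congr (_ * _); apply/cvg_lim.
pose B r := G_ n @^-1` [set r].
have mB r : measurable (B r) by exact: measurable_sfunP.
have m1 r : measurable_fun setT (fun t => \1_(B r) (Z t) : R).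
  by apply: measurableT_comp => //; exact: measurable_indic.
have r0 r s : (0 <= r * \1_(B r) s)%R.
  have := nnfun_muleindic_ge0 (G_ n) r s.
  by rewrite -EFinM lee_fin.
have fimE s : G_ n s = (\sum_(r \in range (G_ n)) r * \1_(B r) s)%R.
  by rewrite fimfunE.
under eq_integral do rewrite fimE mulr_fsumr// -fsumEFin//.
rewrite ge0_integral_fsum//=; last 2 first.
- move=> r; apply/measurable_EFinP; apply: measurable_funM => //.
  exact: measurable_funM.
- by move=> r t _; rewrite lee_fin mulr_ge0.
under [X in _ = _ * X]eq_integral do rewrite fimE -fsumEFin//.
rewrite ge0_integral_fsum//=; last 2 first.
- by move=> r; apply/measurable_EFinP; exact: measurable_funM.
- by move=> r t _; rewrite lee_fin.
rewrite ge0_mule_fsumr; last first.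
  by move=> r; apply: integral_ge0 => t _; rewrite lee_fin.
apply: eq_fsbigr => r _.
(* The level set of a negative [r] is empty, so its term vanishes on both sides. *)
have [r_ge0|r_lt0] := leP 0%R r.
  under eq_integral do rewrite mulrCA EFinM.
  rewrite ge0_integralZl_EFin//; last 2 first.
  - by move=> t _; rewrite lee_fin mulr_ge0.
  - by apply/measurable_EFinP; exact: measurable_funM.
  rewrite UindicE//; under [in RHS]eq_integral do rewrite EFinM.
  rewrite ge0_integralZl_EFin//; last exact/measurable_EFinP.
  by rewrite muleCA.
have B0 s : \1_(B r) s = 0%R :> R.
  rewrite indicE; apply/eqP; rewrite pnatr_eq0 eqb0; apply/negP.
  by rewrite inE /B /= => Gsr; move: r_lt0; rewrite -Gsr ltNge => /negP; apply.
under eq_integral do rewrite B0 2!mulr0.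
under [in RHS]eq_integral do rewrite B0 mulr0.
by rewrite integral0 mule0.
Qed.

End product_rule.

Section independent_product.
Local Open Scope ereal_scope.
Context d d' (T : measurableType d) (S : measurableType d') (R : realType).
Variables (P : probability T R) (I : finType) (Z : I -> T -> S).
Hypothesis mZ : forall i, measurable_fun setT (Z i).
Hypothesis indepZ : mutually_independent P Z.

Let indic_fin (B : set S) i : measurable B ->
  \int[P]_w (\1_B (Z i w) : R)%:E = P (Z i @^-1` B).
Proof.
move=> mB; rewrite -[Z i @^-1` B]setIT -integral_indic//; last first.
  by rewrite -[X in measurable X]setTI; exact: mZ.
Qed.

(* Starting from indicators, the factors are replaced by the [G i] one at a time. *)
Lemma independent_prod_ge0 (G : I -> S -> R) :
    (forall i, measurable_fun setT (G i)) -> (forall i s, (0 <= G i s)%R) ->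
    (forall i, \int[P]_w (G i (Z i w))%:E \is a fin_num) ->
  \int[P]_w (\prod_i G i (Z i w))%:E = \prod_i \int[P]_w (G i (Z i w))%:E.
Proof.
have : forall i, i \notin enum I -> exists2 B, measurable B & G i = \1_B.
  by move=> i; rewrite mem_enum.
elim: (enum I) G => [|x s IHs] G indG mG G0 finG.
  have /choice[B /all_and2[mB GB]] : forall i, exists B, measurable B /\ G i = \1_B.
    by move=> i; have [B mB GB] := indG i isT; exists B.
  transitivity (\int[P]_w (\1_(\bigcap_(i in [set` [set: I]%SET]) (Z i @^-1` B i)) w)%:E).
    apply: eq_integral => w _; congr EFin.
    rewrite indicE; have [wB|nwB] := pselect ((\bigcap_(i in [set` [set: I]%SET]) (Z i @^-1` B i)) w).
      rewrite mem_set// big1// => i _; rewrite GB indicE mem_set//.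
      by apply: wB; rewrite /= inE.
    rewrite memNset//; have [i niB] : exists i, ~ B i (Z i w).
      by apply/existsNP => wB; apply: nwB => i _; exact: wB.
    by rewrite (bigD1 i)//= GB indicE memNset// mul0r.
  rewrite integral_indic//; last first.
    apply: fin_bigcap_measurable => // i _.
    by rewrite -[X in measurable X]setTI; exact: mZ.
  rewrite setIT; transitivity (\prod_(i in [set: I]%SET) P (Z i @^-1` B i)).
    exact: indepZ.
  apply: eq_big => [i|i _]; first by rewrite inE.
  by rewrite GB indic_fin.
pose c := \prod_(i | i != x) \int[P]_w (G i (Z i w))%:E.
have int0 i : 0 <= \int[P]_w (G i (Z i w))%:E.
  by apply: integral_ge0 => w _; rewrite lee_fin.
pose U w := (\prod_(i | i != x) G i (Z i w))%R.
rewrite (bigD1 x)//= muleC -/c.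
rewrite -(@ge0_integralM_comp _ _ _ _ _ P U (Z x) _ _ _ c (G x))//.
- by apply: eq_integral => w _; rewrite (bigD1 x)//= mulrC.
- rewrite /U; under eq_fun do rewrite -big_filter.
  by apply: measurable_prod => i _; exact: measurableT_comp.
- by move=> w; apply: prodr_ge0.
- exact: prode_ge0.
- exact: prode_fin_num.
move=> B mB.
(* With an indicator as factor [x], the induction hypothesis applies and provides the premise of the
   product rule. *)
pose G' i := if i == x then \1_B else G i : S -> R.
have G'x : G' x = \1_B by rewrite /G' eqxx.
have G'i i : i != x -> G' i = G i by rewrite /G' => /negbTE ->.
transitivity (\int[P]_w (\prod_i G' i (Z i w))%:E).
  apply: eq_integral => w _; rewrite (bigD1 x)//= G'x mulrC /U.
  by under [in RHS]eq_bigr => i ix do rewrite G'i//.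
rewrite IHs.
- rewrite (bigD1 x)//= G'x muleC /c.
  by under [in RHS]eq_bigr => i ix do rewrite -G'i//.
- move=> i ins; have [->|ix] := eqVneq i x; first by exists B.
  by rewrite G'i//; apply: indG; rewrite inE negb_or ix.
- by move=> i; have [->|ix] := eqVneq i x; rewrite ?G'x// G'i.
- move=> i t; have [->|ix] := eqVneq i x; last by rewrite G'i.
  by rewrite G'x.
- move=> i; have [->|ix] := eqVneq i x; last by rewrite G'i.
  by rewrite G'x indic_fin// fin_num_measure// -[X in measurable X]setTI; exact: mZ.
Qed.

(** Markov's inequality for the exponential of the sum; the Chernoff parameter is absorbed in
    [g]. *)
Lemma independent_chernoff (g : S -> R) (c y : R) :
    measurable_fun setT g ->
    (forall i, \int[P]_w (expR (g (Z i w)))%:E <= (expR c)%:E) ->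
  P [set w | (y <= \sum_i g (Z i w))%R] <= (expR (#|I|%:R * c - y))%:E.
Proof.
move=> mg gc.
have mgZ : measurable_fun setT (fun w => \sum_i g (Z i w))%R.
  by apply: measurable_sum => i; exact: measurableT_comp.
have mA : measurable [set w | (y <= \sum_i g (Z i w))%R].
  rewrite [X in measurable X](_ : _ =
    (fun w => \sum_i g (Z i w))%R @^-1` `[y, +oo[); last first.
    by apply/seteqP; split => w /=; rewrite in_itv/= andbT.
  by rewrite -[X in measurable X]setTI; exact: mgZ.
have mexp : measurable_fun setT (fun s => expR (g s)) by exact: measurableT_comp.
have int0 i : 0 <= \int[P]_w (expR (g (Z i w)))%:E.
  by apply: integral_ge0 => w _; rewrite lee_fin expR_ge0.
rewrite -[X in P X]setIT -integral_indic//.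
apply: (@le_trans _ _ (\int[P]_w ((expR (- y))%:E * (\prod_i expR (g (Z i w)))%:E))).
  apply: ge0_le_integral => //.
  - by apply/measurable_EFinP.
  - apply/measurable_EFinP; apply: measurable_funM => //.
    by apply: measurable_prod => i _; exact: (measurableT_comp mexp (mZ i)).
  - move=> w _; rewrite -(big_morph expR (@expRD R) (@expR0 R)) -EFinM lee_fin -expRD indicE.
    have [wA|wA] := pselect ([set w | (y <= \sum_i g (Z i w))%R] w).
      by rewrite mem_set// -[leLHS]expR0 ler_expR addrC subr_ge0.
    by rewrite memNset// expR_ge0.
rewrite ge0_integralZl//; last 2 first.
- by apply/measurable_EFinP; apply: measurable_prod => i _; exact: (measurableT_comp mexp (mZ i)).
- by move=> w _; rewrite lee_fin prodr_ge0// => i _; rewrite expR_ge0.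
rewrite (independent_prod_ge0 (G := fun=> fun s => expR (g s)))//; last first.
  by move=> i; rewrite ge0_fin_numE//; exact: le_lt_trans (gc i) (ltry _).
rewrite addrC expRD EFinM lee_wpmul2l ?lee_fin ?expR_ge0//.
pose r i := fine (\int[P]_w (expR (g (Z i w)))%:E).
have rE i : \int[P]_w (expR (g (Z i w)))%:E = (r i)%:E.
  by rewrite fineK// ge0_fin_numE// (le_lt_trans (gc i)) ?ltry.
under eq_bigr do rewrite rE.
rewrite prodEFin lee_fin expRM_natl -prodr_const; apply: ler_prod => i _.
by rewrite -!lee_fin -rE int0 gc.
Qed.

End independent_product.

Lemma sum_half_powers (R : realFieldType) N : \sum_(k < N) 2 ^- k <= 2 :> R.
Proof.
suff -> : \sum_(k < N) 2 ^- k = 2 - 2 * 2 ^- N :> R.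
  by rewrite gerBl mulr_ge0// invr_ge0 exprn_ge0.
elim: N => [|N IH]; first by rewrite big_ord0 expr0 invr1 mulr1 subrr.
by rewrite big_ord_recr/= IH exprS invfM mulrA divff//; lra.
Qed.

Section moment_of_tails.
Context d (T : measurableType d) (R : realType) (P : probability T R).

Import HBNNSimple.

(* No measurability is needed, as the integral of a nonnegative function is a
   supremum over the simple functions below it. *)
Lemma ge0_le_integral_nonmeasurable (f g : T -> \bar R) :
  (forall w, 0 <= f w)%E -> (forall w, f w <= g w)%E ->
  (\int[P]_w f w <= \int[P]_w g w)%E.
Proof.
move=> f0 fg; have g0 w : (0 <= g w)%E by apply: le_trans (fg w).
rewrite !ge0_integralTE//; apply: le_ereal_sup => _ [h hf <-].
by exists h => // w; exact: le_trans (hf w) (fg w).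
Qed.

(** Where [D] lies between 2^k s and 2^(k+1) s, its power [p] is at most s^p 2^((k+1) q); so s^p
    times [1 + \sum F k] dominates it everywhere. The exponent [q + 1] in the tails leaves a factor
    2^(-k), and the series converges. *)
Lemma moment_le_of_dyadic_tails (D : T -> R) (p s C : R) (q : nat) :
    0 <= p -> p <= q%:R -> 0 < s -> 0 <= C -> (forall w, 0 <= D w) ->
    (forall k, exists B : set T, [/\ measurable B,
      [set w | 2 ^+ k * s <= D w] `<=` B & (P B <= (C / 2 ^+ (k * q.+1))%:E)%E]) ->
  ('E_P[(fun w => D w `^ p)%R] <= ((1 + 2 ^+ q.+1 * C) * s `^ p)%:E)%E.
Proof.
move=> p0 pq s0 C0 D0 /choice[B /all_and3[mB DB PB]].
pose F k w : \bar R := ((2 ^+ (k.+1 * q))%:E * (\1_(B k) w)%:E)%E.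
have F0 k w : (0 <= F k w)%E by rewrite mule_ge0// lee_fin ?exprn_ge0.
have mF k : measurable_fun setT (F k).
  by apply/measurable_funeM/measurable_EFinP.
rewrite unlock.
apply: (@le_trans _ _ (\int[P]_w ((s `^ p)%:E * (1 + \sum_(k <oo) F k w)))%E).
  apply: ge0_le_integral_nonmeasurable => w; first by rewrite lee_fin powR_ge0.
  have sumF0 : (0 <= \sum_(k <oo) F k w)%E by exact: nneseries_ge0.
  have [Ds|sD] := ltP (D w) s.
    apply: (@le_trans _ _ ((s `^ p)%:E * 1)%E).
      by rewrite mule1 lee_fin ge0_ler_powR// ?nnegrE// ltW.
    by rewrite lee_wpmul2l// ?lee_fin ?powR_ge0// leeDl.
  have [k [kD Dk]] : exists k, 2 ^+ k * s <= D w /\ D w < 2 ^+ k.+1 * s.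
    have ex : exists k, D w < 2 ^+ k * s.
      exists (Num.truncn (D w / s)).+1; rewrite -ltr_pdivrMr//.
      apply: lt_trans (truncnS_gt _) _.
      by rewrite -natrX ltr_nat ltn_expl.
    case: (ex_minnP ex) => -[|k] Dk mink.
      by move: Dk; rewrite expr0 mul1r ltNge sD.
    by exists k; split => //; rewrite leNgt; apply/negP => /mink; rewrite ltnn.
  apply: (@le_trans _ _ ((s `^ p)%:E * (F k w))%E).
    rewrite /F indicE mem_set; last by apply: DB.
    rewrite mule1 -EFinM lee_fin.
    apply: (@le_trans _ _ ((2 ^+ k.+1 * s) `^ p)).
      by rewrite ge0_ler_powR// ?nnegrE ?mulr_ge0 ?exprn_ge0// ltW.
    have -> : (2 ^+ k.+1 * s) `^ p = s `^ p * (2 ^+ k.+1) `^ p.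
      by rewrite mulrC powRM// ltW.
    rewrite ler_wpM2l ?powR_ge0//.
    have ge1 : 1 <= 2 ^+ k.+1 :> R by rewrite -natrX ler1n expn_gt0.
    rewrite exprM -[leRHS]powR_mulrn ?exprn_ge0//.
    exact: ler_powR.
  rewrite lee_wpmul2l// ?lee_fin ?powR_ge0//.
  rewrite -[leLHS]add0e leeD ?lee01//.
  apply: le_trans (nneseries_lim_ge k.+1 _) => //.
  by rewrite big_nat_recr//= leeDr// sume_ge0.
rewrite ge0_integralZl//; last 3 first.
- by apply: emeasurable_funD => //; apply: ge0_emeasurable_sum.
- by move=> w _; rewrite adde_ge0// nneseries_ge0.
- by rewrite lee_fin powR_ge0.
rewrite mulrC EFinM lee_wpmul2l// ?lee_fin ?powR_ge0//.
rewrite ge0_integralD//; last 2 first.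
- by move=> w _; rewrite nneseries_ge0.
- exact: ge0_emeasurable_sum.
have -> : (\int[P]__ 1 = 1 :> \bar R)%E.
  by rewrite integral_cst// mul1e; exact: probability_setT.
rewrite EFinD leeD2l//.
rewrite integral_nneseries//.
apply: lime_le.
  by apply: is_cvg_nneseries => k _ _; apply: integral_ge0.
apply: nearW => N.
apply: (@le_trans _ _ (\sum_(0 <= k < N) (2 ^+ q * C * 2 ^- k)%:E)%E).
  apply: lee_sum => k _; rewrite /F ge0_integralZl//; last exact/measurable_EFinP.
  rewrite integral_indic// setIT.
  apply: (@le_trans _ _ ((2 ^+ (k.+1 * q))%:E * (C / 2 ^+ (k * q.+1))%:E)%E).
    by apply: lee_wpmul2l; [rewrite lee_fin exprn_ge0|exact: PB].
  rewrite -EFinM lee_fin le_eqVlt; apply/orP; left; apply/eqP.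
  rewrite mulSn mulnS !exprD; field.
  by rewrite !expf_neq0.
rewrite sumEFin lee_fin -mulr_sumr big_mkord exprS.
have := sum_half_powers R N; have : 0 <= 2 ^+ q * C by rewrite mulr_ge0// exprn_ge0.
by nra.
Qed.

End moment_of_tails.

(** * Chaining and peeling *)

(** The exponential of [y / q] is at least [y / q]; raise this to the power [q] and invert. *)
Lemma expRN_le_power (R : realType) (q : nat) (y : R) : 0 < y ->
  expR (- y) <= (q%:R / y) ^+ q.
Proof.
move=> y0; case: q => [|q]; first by rewrite expr0 expR_le1 oppr_le0 ltW.
have yq0 : 0 < y / q.+1%:R by rewrite divr_gt0.
rewrite -[_ / y]invf_div exprVn expRN lef_pV2 ?posrE ?exprn_gt0 ?expR_gt0//.
have {2}-> : y = q.+1%:R * (y / q.+1%:R) by rewrite mulrCA divff// mulr1.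
rewrite expRM_natl lerXn2r ?nnegrE ?expR_ge0 ?(ltW yq0)//.
by apply: le_trans (expR_ge1Dx _); rewrite lerDr.
Qed.

Section union_bound.
Context d (T : measurableType d) (R : realType) (P : probability T R).

Lemma union_bound N (B : nat -> set T) (b : nat -> R) :
    (forall i, (i < N)%N -> measurable (B i) /\ (P (B i) <= (b i)%:E)%E) ->
  measurable (\bigcup_(i < N) B i) /\
  (P (\bigcup_(i < N) B i) <= (\sum_(i < N) b i)%:E)%E.
Proof.
elim: N => [_|N IH HB]; first by rewrite !bigcup_mkord !big_ord0 measure0.
have [|mU PU] := IH; first by move=> i iN; apply: HB; rewrite ltnS ltnW.
have [mN PN] := HB N (ltnSn _).
rewrite bigcup_mkord big_ord_recr/= -bigcup_mkord; split; first exact: measurableU.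
rewrite big_ord_recr/= EFinD; apply: le_trans (measureU2 _ mU mN) _.
exact: leeD.
Qed.

Lemma union_bound2 (B C : set T) (b c : R) :
    measurable B /\ (P B <= b%:E)%E -> measurable C /\ (P C <= c%:E)%E ->
  measurable (B `|` C) /\ (P (B `|` C) <= (b + c)%:E)%E.
Proof.
move=> [mB PB] [mC PC]; split; first exact: measurableU.
by rewrite EFinD; apply: le_trans (measureU2 _ mB mC) _; exact: leeD.
Qed.

End union_bound.

(** Binary expansion of [i]: an odd [i] splits off one cell of the finest level, and [i./2] is the
    same grid point one level up. Each level contributes at most one cell. *)
Lemma dyadic_partial_sum (R : realType) (n : nat) (xi e : 'I_n -> R) (z : R)
    (eta : nat -> R) (J : nat) : 0 < z -> (forall j, 0 <= eta j) ->
    (forall j i, (j <= J)%N -> (i <= 2 ^ j)%N ->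
      \sum_(l | z * i%:R / 2 ^+ j <= xi l < z * i.+1%:R / 2 ^+ j) e l <= eta j) ->
  forall i, (i <= 2 ^ J)%N ->
  \sum_(l | 0 <= xi l < z * i%:R / 2 ^+ J) e l <= \sum_(j < J.+1) eta j.
Proof.
move=> z0 eta0; elim: J => [|J IH] H i iJ.
  rewrite big_ord1; case: i iJ => [|[|//]] _.
    by rewrite big1// => l; rewrite mulr0 mul0r => /andP[/le_lt_trans/[apply]]; rewrite ltxx.
  by have := H 0 0 isT isT; rewrite mulr0 mul0r.
rewrite big_ord_recr/=.
have {}IH := IH (fun j i jJ => H j i (leqW jJ)).
have hi : (i./2 <= 2 ^ J)%N by rewrite expnS in iJ; lia.
have hE : z * i./2.*2%:R / 2 ^+ J.+1 = z * i./2%:R / 2 ^+ J.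
  by rewrite -muln2 natrM exprS invfM; field; rewrite expf_neq0.
case: (boolP (odd i)) => iodd; last first.
  have -> : i = i./2.*2 by lia.
  by rewrite hE; apply: le_trans (IH _ hi) _; rewrite lerDl.
have iE : i = (i./2.*2).+1 by lia.
rewrite (bigID (fun l => xi l < z * i./2%:R / 2 ^+ J))/=.
apply: lerD.
  rewrite (_ : \sum_(_ | _) _ = \sum_(l | 0 <= xi l < z * i./2%:R / 2 ^+ J) e l); last first.
    apply: eq_bigl => l; rewrite -andbA; congr (_ && _).
    apply/andb_idl => /lt_le_trans; apply; rewrite -hE.
    by rewrite ler_pM2r ?invr_gt0 ?exprn_gt0// ler_pM2l// ler_nat; lia.
  exact: IH.
have := H J.+1 i./2.*2 (leqnn _) ltac:(lia).
rewrite -iE hE; apply: le_trans; rewrite le_eqVlt; apply/orP; left; apply/eqP.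
apply: eq_bigl => l; case: (leP (z * i./2%:R / 2 ^+ J)) => hx; rewrite ?andbF ?andbT//=.
have -> // : 0 <= xi l.
by apply: le_trans hx; rewrite divr_ge0 ?exprn_ge0// mulr_ge0// ltW.
Qed.

(** The last grid point before [v] is reached by dyadic cells. The rest of [A] lies in a single cell
    of level [J], where absolute values are summed because [A] may contain any part of the ties at
    [v]. For [v = z] that cell is the one of index 2^J, just beyond [z]. *)
Lemma chain_bound (R : realType) (n : nat) (xi e : 'I_n -> R) (z v : R)
    (eta : nat -> R) (zeta : R) (J : nat) (A : {set 'I_n}) :
    0 < z -> 0 <= v <= z -> (forall j, 0 <= eta j) ->
    (forall j i, (j <= J)%N -> (i <= 2 ^ j)%N ->
      \sum_(l | z * i%:R / 2 ^+ j <= xi l < z * i.+1%:R / 2 ^+ j) e l <= eta j) ->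
    (forall i, (i <= 2 ^ J)%N ->
      \sum_(l | z * i%:R / 2 ^+ J <= xi l < z * i.+1%:R / 2 ^+ J) `|e l| < zeta) ->
    (forall l, 0 <= xi l < v -> l \in A) ->
    {in A, forall l, 0 <= xi l <= v} ->
  \sum_(l in A) e l < \sum_(j < J.+1) eta j + zeta.
Proof.
move=> z0 /andP[v0 vz] eta0 Heta Hzeta vA Av.
have J0 : 0 < 2 ^+ J :> R by rewrite exprn_gt0.
pose x := v * 2 ^+ J / z; have x0 : 0 <= x by rewrite divr_ge0 ?mulr_ge0 ?(ltW J0)// ltW.
pose i := Num.truncn x; have /andP[ix xi1] := truncn_itv x0; rewrite -/i in ix xi1.
have iJ : (i <= 2 ^ J)%N.
  rewrite -(ler_nat R) natrX; apply: le_trans ix _.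
  by rewrite ler_pdivrMr// mulrC ler_pM2l.
have zi : z * i%:R / 2 ^+ J <= v by rewrite ler_pdivrMr// mulrC -ler_pdivlMr.
have vzi : v < z * i.+1%:R / 2 ^+ J by rewrite ltr_pdivlMr// [z * _]mulrC -ltr_pdivrMr.
rewrite (bigID (fun l => xi l < z * i%:R / 2 ^+ J))/=; apply: ler_ltD.
  rewrite (_ : \sum_(_ | _) _ = \sum_(l | 0 <= xi l < z * i%:R / 2 ^+ J) e l).
    exact: dyadic_partial_sum.
  apply: eq_bigl => l; apply/andP/andP => -[h1 h2]; split => //.
    by have /andP[] := Av _ h1.
  by apply: vA; rewrite h1 (lt_le_trans h2).
apply: le_lt_trans (Hzeta _ iJ).
apply: (@le_trans _ _ (\sum_(l in A | ~~ (xi l < z * i%:R / 2 ^+ J)) `|e l|)).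
  by apply: ler_sum => l _; exact: ler_norm.
rewrite big_mkcond [leRHS]big_mkcond/=; apply: ler_sum => l _.
case: ifP => [/andP[lA]|_]; last by case: ifP.
rewrite -leNgt => ->; have /andP[_ lv] := Av _ lA.
by rewrite (le_lt_trans lv).
Qed.

Section chaining.
Context d (T : measurableType d) (R : realType) (P : probability T R) (n : nat).
Variables (xi e : 'I_n -> T -> R) (C1 : R).
Hypothesis C1_ge1 : 1 <= C1.

Let S u v w := \sum_(l | u <= xi l w < v) e l w.
Let Sabs u v w := \sum_(l | u <= xi l w < v) `|e l w|.

Hypothesis mS : forall u v y, measurable [set w | y <= S u v w].
Hypothesis mSabs : forall u v y, measurable [set w | y <= Sabs u v w].
Hypothesis tailS : forall theta u v y, 0 <= theta <= 1 -> u <= v ->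
  (P [set w | (y <= S u v w)%R] <=
   (expR (n%:R * (C1 * theta ^+ 2 * (v - u)) - theta * y))%:E)%E.
Hypothesis tailSabs : forall u v y, u <= v ->
  (P [set w | (y <= Sabs u v w)%R] <= (expR (n%:R * (C1 * (v - u)) - y))%:E)%E.

(** From one level to the next the cell length halves while the squared threshold shrinks only by
    49/64, so the Chernoff exponent grows like (49/32)^j. Any ratio between 1 / sqrt 2 and 1 gives
    such growth together with summable thresholds; 7/8 is one choice. *)
Let level_bound D q z y j i : D = 2048 * C1 -> (4 <= q)%N -> (0 < n)%N -> 0 < z -> 0 < y ->
    y * 2 ^+ j <= 8 * C1 ->
  (P [set w | (n%:R * z * y / 16 * (7 / 8) ^+ j <=
     S (z * i%:R / 2 ^+ j) (z * i.+1%:R / 2 ^+ j) w)%R] <=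
   ((D * q%:R / (n%:R * z * y ^+ 2)) ^+ q * 4 ^- j)%:E)%E.
Proof.
move=> DE q4 n0 z0 y0 yj; pose a : R := (7 / 4) ^+ j.
have N0 : 0 < n%:R :> R by rewrite ltr0n.
have C0 : 0 < C1 by exact: lt_le_trans C1_ge1.
have D0 : 0 < D by lra.
have twoj : 0 < 2 ^+ j :> R by rewrite exprn_gt0.
have a0 : 0 < a by rewrite exprn_gt0// divr_gt0.
have a2 : a <= 2 ^+ j by rewrite lerXn2r ?nnegrE//; lra.
(* Half of the optimal parameter: the quadratic term is then a quarter of the linear one, and the
   difference is 3/2 in units of 1 / [D]. The bound on [y * 2 ^+ j] keeps [theta] below 1. *)
pose theta := y * a / (64 * C1).
have th01 : 0 <= theta <= 1.
  apply/andP; split; first by rewrite divr_ge0 ?mulr_ge0 ?ltW// mulr_gt0.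
  rewrite ler_pdivrMr ?mulr_gt0// mul1r.
  by apply: le_trans (le_trans yj _); [rewrite ler_pM2l|lra].
have uv : z * i%:R / 2 ^+ j <= z * i.+1%:R / 2 ^+ j.
  by rewrite ler_pM2r ?invr_gt0// ler_pM2l// ler_nat.
apply: le_trans (tailS _ th01 uv) _; rewrite lee_fin.
pose X := n%:R * z * y ^+ 2; rewrite -/X.
have X0 : 0 < X by rewrite !mulr_gt0 ?exprn_gt0.
have -> : z * i.+1%:R / 2 ^+ j - z * i%:R / 2 ^+ j = z / 2 ^+ j.
  by rewrite -mulrBl -mulrBr -natrB// subSnn mulr1.
have aE : a = (7 / 8) ^+ j * 2 ^+ j by rewrite -exprMn; congr (_ ^+ _); field.
have -> : n%:R * (C1 * theta ^+ 2 * (z / 2 ^+ j)) - theta * (n%:R * z * y / 16 * (7 / 8) ^+ j) =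
    - (3 / 2 * (X * (a * (7 / 8) ^+ j) / D)).
  by rewrite /theta /X aE DE; field; rewrite !gt_eqF.
have -> : a * (7 / 8) ^+ j = (49 / 32) ^+ j.
  by rewrite -exprMn; congr (_ ^+ _); field.
pose Y := X * (3 / 2) ^+ j / D.
have Y0 : 0 < Y by rewrite divr_gt0 ?mulr_gt0 ?exprn_gt0// divr_gt0.
apply: (@le_trans _ _ (expR (- Y))).
  rewrite ler_expR lerN2 /Y.
  apply: (@le_trans _ _ (X * (49 / 32) ^+ j / D)).
    by rewrite ler_pM2r ?invr_gt0// ler_pM2l// lerXn2r ?nnegrE//; lra.
  have : 0 < X * (49 / 32) ^+ j / D.
    by rewrite divr_gt0 ?mulr_gt0 ?exprn_gt0// divr_gt0.
  by move: (_ / D) => r r0; lra.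
apply: le_trans (expRN_le_power q Y0) _.
have -> : q%:R / Y = D * q%:R / X * (2 / 3) ^+ j.
  have -> : (2 / 3) ^+ j = ((3 / 2) ^+ j)^-1 :> R by rewrite -exprVn; congr (_ ^+ _); field.
  by rewrite /Y; field; rewrite !gt_eqF// exprn_gt0// divr_gt0.
have : 0 <= D * q%:R / X by rewrite divr_ge0 ?(ltW X0)// mulr_ge0// ltW.
move: (_ / X) => r r0; rewrite exprMn; apply: ler_wpM2l; first exact: exprn_ge0.
(* (2/3)^4 = 16/81 is below 1/4. The resulting factor [4 ^- j] outweighs the number 2^j + 1 of cells
   at level [j]. *)
have q23 : (2 / 3) ^+ q <= 4^-1 :> R.
  rewrite -(subnKC q4) exprD -[leRHS]mulr1.
  apply: ler_pM; rewrite ?exprn_ge0//; last by apply: exprn_ile1; lra.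
  by lra.
rewrite -exprM mulnC exprM -exprVn lerXn2r ?nnegrE ?exprn_ge0//.
Qed.

(** The lower bound makes the exponential-moment cost of the absolute sums over the finest cells
    small against their threshold; the upper bound keeps the Chernoff parameter admissible at all
    levels and limits the number of cells. *)
Let dyadic_level y : 0 < y -> y <= 1 ->
  exists J, 4 * C1 <= y * 2 ^+ J /\ y * 2 ^+ J <= 8 * C1.
Proof.
move=> y0 y1; have C0 : 0 < C1 by exact: lt_le_trans C1_ge1.
have ex : exists J, 4 * C1 <= y * 2 ^+ J.
  exists (Num.truncn (4 * C1 / y)).+1; rewrite -ler_pdivrMl// mulrC.
  apply: le_trans (ltW (truncnS_gt _)) _.
  by rewrite -natrX ler_nat ltnW// ltn_expl.
case: (ex_minnP ex) => -[|J] HJ minJ.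
  by exists 0%N; split => //; rewrite expr0 mulr1; have := C1_ge1; lra.
exists J.+1; split => //; rewrite exprS mulrCA.
have : y * 2 ^+ J < 4 * C1.
  by rewrite ltNge; apply/negP => /minJ; rewrite ltnn.
by lra.
Qed.

Let sum_seven_eighths N : \sum_(j < N) (7 / 8) ^+ j <= 8 :> R.
Proof.
suff -> : \sum_(j < N) (7 / 8) ^+ j = 8 - 8 * (7 / 8) ^+ N :> R.
  by rewrite gerBl mulr_ge0// exprn_ge0// divr_ge0.
elim: N => [|N IH]; first by rewrite big_ord0 expr0 mulr1 subrr.
by rewrite big_ord_recr/= IH exprS; lra.
Qed.

(* Chaining: at level [j] the increments are compared with thresholds decreasing
   like [(7 / 8) ^ j], with a Chernoff parameter increasing like [(7 / 4) ^ j].  The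
   parameter reaches order 1 when [2 ^ J] is of order [C1 / y]; there the chain
   stops, as the sums of absolute values over intervals of length [z / 2 ^ J] are
   already small. *)
Lemma maximal_inequality D q z y : D = 2048 * C1 -> (4 <= q)%N -> (0 < n)%N ->
    0 < z -> 0 < y <= 1 ->
  exists B : set T, [/\ measurable B,
    (P B <= (5 * (D * q%:R / (n%:R * z * y ^+ 2)) ^+ q)%:E)%E &
    forall w, ~ B w -> forall v (A : {set 'I_n}), 0 <= v <= z ->
      (forall l, 0 <= xi l w < v -> l \in A) ->
      {in A, forall l, 0 <= xi l w <= v} ->
      \sum_(l in A) e l w < n%:R * z * y].
Proof.
move=> DE q4 n0 z0 /andP[y0 y1]; have [J [J1 J2]] := dyadic_level y0 y1.
have N0 : 0 < n%:R :> R by rewrite ltr0n.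
have C1' := C1_ge1; have C0 : 0 < C1 by exact: lt_le_trans C1_ge1.
have D0 : 0 < D by lra.
set r := (D * _ / _) ^+ q.
have r0 : 0 <= r by rewrite exprn_ge0// divr_ge0 ?mulr_ge0// ltW.
(* The powers of 7/8 sum to at most 8, so the thresholds use up half of [n z y]; the other half is
   left to the last cell. *)
pose eta j : R := n%:R * z * y / 16 * (7 / 8) ^+ j.
pose E j i := [set w | eta j <= S (z * i%:R / 2 ^+ j) (z * i.+1%:R / 2 ^+ j) w].
pose F i := [set w | n%:R * z * y / 2 <= Sabs (z * i%:R / 2 ^+ J) (z * i.+1%:R / 2 ^+ J) w].
have HE j : (j < J.+1)%N -> measurable (\bigcup_(i < (2 ^ j).+1) E j i) /\
    (P (\bigcup_(i < (2 ^ j).+1) E j i) <= (2 * r * 2 ^- j)%:E)%E.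
  move=> jJ; have yj : y * 2 ^+ j <= 8 * C1.
    by apply: le_trans J2; rewrite ler_pM2l// ler_eXn2l ?ltr1n//.
  have [|mU PU] := @union_bound _ _ _ P (2 ^ j).+1 (E j) (fun=> r * 4 ^- j).
    move=> i _; split; first exact: mS.
    exact: level_bound.
  split=> //; apply: le_trans PU _; rewrite lee_fin sumr_const card_ord -[leLHS]mulr_natl.
  have -> : 2 * r * 2 ^- j = (2 * 2 ^+ j) * (r * 4 ^- j).
    have -> : 4 ^+ j = 2 ^+ j * 2 ^+ j :> R by rewrite -exprMn; congr (_ ^+ _); lra.
    by field; rewrite expf_neq0.
  apply: ler_wpM2r; first by rewrite mulr_ge0// invr_ge0 exprn_ge0.
  rewrite -natr1 natrX; have : 1 <= 2 ^+ j :> R by rewrite exprn_ege1// ler1n.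
  by move: (2 ^+ _) => u; lra.
have [mEE PEE] := @union_bound _ _ _ P J.+1 (fun j => \bigcup_(i < (2 ^ j).+1) E j i) _ HE.
have HF i : (i < (2 ^ J).+1)%N -> measurable (F i) /\
    (P (F i) <= (r * (4 * y / D))%:E)%E.
  move=> _; split; first exact: mSabs.
  have uv : z * i%:R / 2 ^+ J <= z * i.+1%:R / 2 ^+ J.
    by rewrite ler_pM2r ?invr_gt0 ?exprn_gt0// ler_pM2l// ler_nat.
  apply: le_trans (tailSabs _ uv) _; rewrite lee_fin.
  have -> : z * i.+1%:R / 2 ^+ J - z * i%:R / 2 ^+ J = z / 2 ^+ J.
    by rewrite -mulrBl -mulrBr -natrB// subSnn mulr1.
  have J0 : 0 < 2 ^+ J :> R by rewrite exprn_gt0.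
  have nzy0 : 0 < n%:R * z * y / 4 by rewrite divr_gt0 ?mulr_gt0.
  apply: (@le_trans _ _ (expR (- (n%:R * z * y / 4)))).
    rewrite ler_expR; suff : C1 * (z / 2 ^+ J) <= z * y / 4.
      by rewrite -(ler_pM2l N0); lra.
    by rewrite mulrA ler_pdivrMr//; nra.
  apply: le_trans (expRN_le_power q nzy0) _.
  (* The factor [4 * y / D] pays for the 2^J + 1 finest cells, whose number is at most 16 C1 / y. *)
  have -> : q%:R / (n%:R * z * y / 4) =
      (D * q%:R / (n%:R * z * y ^+ 2)) * (4 * y / D) by field; rewrite !gt_eqF.
  rewrite exprMn -/r; apply: ler_wpM2l => //.
  have yD0 : 0 <= 4 * y / D by rewrite divr_ge0 ?mulr_ge0 ?(ltW y0)// ltW.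
  have yD1 : 4 * y / D <= 1 by rewrite ler_pdivrMr//; lra.
  by rewrite -[leRHS]expr1; apply: ler_wiXn2l => //; exact: leq_trans q4.
have [mFF PFF] := @union_bound _ _ _ P _ F _ HF.
have [mB PB] := union_bound2 (conj mEE PEE) (conj mFF PFF).
exists ((\bigcup_(j < J.+1) \bigcup_(i < (2 ^ j).+1) E j i) `|` (\bigcup_(i < (2 ^ J).+1) F i)).
split => //.
  apply: le_trans PB _; rewrite lee_fin.
  have -> : 5 * r = 4 * r + r by lra.
  apply: lerD.
    rewrite -mulr_sumr; have := sum_half_powers R J.+1.
    by have : 0 <= 2 * r by [lra]; nra.
  rewrite sumr_const card_ord -[leLHS]mulr_natl mulrCA -[leRHS]mulr1; apply: ler_wpM2l => //.
  apply: (@le_trans _ _ (2 * 2 ^+ J * (4 * y / D))).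
    apply: ler_wpM2r; first by rewrite divr_ge0 ?mulr_ge0 ?(ltW y0)// ltW.
    rewrite -natr1 natrX; have : 1 <= 2 ^+ J :> R by rewrite exprn_ege1// ler1n.
  by move: (2 ^+ _) => u; lra.
  by rewrite mulrA ler_pdivrMr// mul1r; lra.
move=> w nB v A v0z vA Av.
have Heta j i : (j <= J)%N -> (i <= 2 ^ j)%N ->
    S (z * i%:R / 2 ^+ j) (z * i.+1%:R / 2 ^+ j) w <= eta j.
  move=> jJ ij; rewrite leNgt; apply/negP => /ltW wE.
  by apply: nB; left; exists j => //=; exists i.
have Hzeta i : (i <= 2 ^ J)%N ->
    Sabs (z * i%:R / 2 ^+ J) (z * i.+1%:R / 2 ^+ J) w < n%:R * z * y / 2.
  move=> iJ; rewrite ltNge; apply/negP => wF.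
  by apply: nB; right; exists i.
have eta0 j : 0 <= eta j by rewrite mulr_ge0 ?exprn_ge0 ?divr_ge0 ?mulr_ge0 ?(ltW z0) ?(ltW y0).
have := chain_bound z0 v0z eta0 Heta Hzeta vA Av.
move=> /lt_le_trans; apply.
rewrite -mulr_sumr; have := sum_seven_eighths J.+1.
have : 0 < n%:R * z * y by rewrite !mulr_gt0.
by move: (n%:R * z * y) (\sum_(_ < _) _) => a b a0 b8; nra.
Qed.

(** [c0] is the fraction of [delta + z] granted to the noise at scale [z]: [16 * c0 <= A3] matches
    it with the drift from [delta], [32 * c0 <= A1 * A3] with the drift from the slope, and
    [c0 <= 1/2] keeps the threshold at most 1. [E] is large enough to cover both the maximal
    inequality and the count of samples. *)
Variables (A1 A3 m c0 E D : R) (q : nat).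
Hypotheses (A1_gt0 : 0 < A1) (A3_gt0 : 0 < A3) (m_le1 : m <= 1).
Hypotheses (c0_gt0 : 0 < c0) (c0_le : c0 <= 2^-1) (c0_A3 : 16 * c0 <= A3).
Hypotheses (c0_A1A3 : 32 * c0 <= A1 * A3).
Hypotheses (DE : D = 2048 * C1) (E_D : D <= E * c0 ^+ 2) (E_A3 : 32 <= E * A3).
Hypotheses (n_gt0 : (0 < n)%N) (q4 : (4 <= q)%N).
Hypothesis xi_le : forall l w, xi l w <= m.

Let N u v w : R := \sum_(l | u <= xi l w < v) 1.

Hypothesis mN : forall u v y, measurable [set w | N u v w <= y].
Hypothesis tailN : forall u v y, 0 <= u -> u <= v -> v <= m ->
  (P [set w | (N u v w <= y)%R] <=
   (expR (y - n%:R * (A3 * (v - u) / 2)))%:E)%E.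

(** Outside a small event [z/2, z[ holds more than n A3 z / 8 samples, a quarter of the guaranteed
    mean, each with drift at least [delta + A1 z / 2]. This beats the noise over all of [0, 2z]. *)
Let drift_one_scale z delta : 0 < z -> z <= m -> 0 <= delta <= 1 ->
  exists B : set T, [/\ measurable B,
    (P B <= (6 * (E * q%:R / (n%:R * z * (delta + z) ^+ 2)) ^+ q)%:E)%E &
    forall w, ~ B w -> (exists l, z / 2 <= xi l w < z) /\
      forall v (A : {set 'I_n}), z <= v <= 2 * z ->
      (forall l, 0 <= xi l w < v -> l \in A) ->
      {in A, forall l, 0 <= xi l w <= v} ->
      \sum_(l in A) (e l w - delta - A1 * xi l w) < 0].
Proof.
move=> z0 zm /andP[delta0 delta1].
move: (A1_gt0) (A3_gt0) (m_le1) (c0_gt0) (c0_le) => A1_0 A3_0 m1 c0_0 c0_2.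
move: (c0_A3) (c0_A1A3) (E_D) (E_A3) => c0_3 c0_13 ED EA3.
have N0 : 0 < n%:R :> R by rewrite ltr0n.
have z1 : z <= 1 by exact: le_trans m1.
have [y yE] : exists y, y = c0 * (delta + z) by exists (c0 * (delta + z)).
have y01 : 0 < y <= 1 by rewrite yE mulr_gt0 ?ltr_wpDl//=; nra.
have y0 : 0 < y by case/andP: y01.
have D0 : 0 <= D by rewrite DE; have := C1_ge1; lra.
have [B1 [mB1 PB1 HB1]] := maximal_inequality DE q4 n_gt0 (mulr_gt0 (@ltr0n R 2) z0) y01.
pose B2 := [set w | N (z / 2) z w <= n%:R * A3 * z / 8].
have z20 : 0 <= z / 2 by rewrite divr_ge0// ltW.
have z2z : z / 2 <= z by lra.
have r0 : 0 < E * q%:R / (n%:R * z * (delta + z) ^+ 2).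
  rewrite divr_gt0 ?mulr_gt0 ?exprn_gt0 ?ltr_wpDl// ?ltr0n; last exact: leq_trans q4.
  by rewrite -(pmulr_lgt0 _ A3_0); lra.
have PB2 : (P B2 <= ((E * q%:R / (n%:R * z * (delta + z) ^+ 2)) ^+ q)%:E)%E.
  apply: le_trans (tailN _ z20 z2z zm) _; rewrite lee_fin.
  have A0 : 0 < n%:R * A3 * z / 8 by rewrite divr_gt0 ?mulr_gt0.
  have -> : n%:R * A3 * z / 8 - n%:R * (A3 * (z - z / 2) / 2) = - (n%:R * A3 * z / 8) by field.
  apply: le_trans (expRN_le_power q A0) _.
  apply: lerXn2r; rewrite ?nnegrE ?(ltW r0)//; first by rewrite divr_ge0// ltW.
  rewrite ler_pdivrMr// mulrAC ler_pdivlMr; last first.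
    by rewrite !mulr_gt0 ?exprn_gt0 ?ltr_wpDl.
  (* The tail of the count involves only [n z]; since [delta + z <= 2], it still fits the common
     form of the bound. *)
  have dz2 : (delta + z) ^+ 2 <= 4 by nra.
  have -> : E * q%:R * (n%:R * A3 * z / 8) = q%:R * (n%:R * z) * (E * A3 / 8) by field.
  rewrite [leLHS]mulrA; apply: ler_wpM2l; first by rewrite !mulr_ge0// ltW.
  by lra.
have [mB PB] := union_bound2 (conj mB1 PB1) (conj (mN _ _ _) PB2).
exists (B1 `|` B2); split => //.
  apply: le_trans PB _; rewrite lee_fin.
  have -> : forall a : R, 6 * a = 5 * a + a by move=> a; lra.
  rewrite lerD2r ler_pM2l//; apply: lerXn2r; rewrite ?nnegrE ?(ltW r0)//.
    by rewrite divr_ge0 ?mulr_ge0 ?exprn_ge0 ?(ltW z0) ?(ltW y0).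
  have dz0 : 0 < delta + z by rewrite ltr_wpDl.
  rewrite ler_pdivrMr; last by rewrite !mulr_gt0 ?exprn_gt0.
  have -> : E * q%:R / (n%:R * z * (delta + z) ^+ 2) * (n%:R * (2 * z) * y ^+ 2) =
    q%:R * (2 * (E * c0 ^+ 2)) by rewrite yE; field; rewrite !gt_eqF.
  rewrite mulrC; apply: ler_wpM2l => //.
  have : 0 <= E * c0 ^+ 2 by exact: le_trans D0 ED.
  by move: ED; move: (E * _) => b; lra.
move=> w nB.
have Nw : n%:R * A3 * z / 8 < N (z / 2) z w.
  by rewrite ltNge; apply/negP => Nw; apply: nB; right.
split.
  apply: contrapT => nl; move: Nw; rewrite /N big_pred0.
    by rewrite ltNge divr_ge0 ?mulr_ge0 ?ltW.
  by move=> l; apply/negP => lz; apply: nl; exists l.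
move=> v A /andP[zv vz] vA Av.
have v0z : 0 <= v <= 2 * z by rewrite (le_trans (ltW z0)).
have nB1 : ~ B1 w by move=> B1w; apply: nB; left.
have sum_e := HB1 w nB1 v A v0z vA Av.
suff sum_drift : n%:R * (2 * z) * y <= \sum_(l in A) (delta + A1 * xi l w).
  under eq_bigr do rewrite -addrA -opprD.
  by rewrite sumrB subr_lt0; exact: lt_le_trans sum_drift.
apply: (@le_trans _ _ ((delta + A1 * (z / 2)) * (n%:R * A3 * z / 8))).
  have -> : n%:R * (2 * z) * y = n%:R * z * (2 * c0 * (delta + z)) by rewrite yE; ring.
  have -> : (delta + A1 * (z / 2)) * (n%:R * A3 * z / 8) =
    n%:R * z * (A3 * delta / 8 + A1 * A3 * z / 16) by field.
  apply: ler_wpM2l; first by rewrite mulr_ge0// ltW.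
  have : 16 * c0 * delta <= A3 * delta by exact: ler_wpM2r.
  have : 32 * c0 * z <= A1 * A3 * z by apply: ler_wpM2r => //; exact: ltW.
  by lra.
apply: (@le_trans _ _ ((delta + A1 * (z / 2)) * N (z / 2) z w)).
  apply: ler_wpM2l; last exact: ltW.
  by rewrite addr_ge0// mulr_ge0// ltW.
rewrite /N mulr_sumr big_mkcond [leRHS]big_mkcond/=; apply: ler_sum => l _.
case: ifP => [/andP[zl lz]|_].
  rewrite vA; last by rewrite (le_trans z20 zl) (lt_le_trans lz).
  by rewrite mulr1 lerD2l ler_pM2l.
case: ifP => // /Av/andP[xi0 _].
by rewrite addr_ge0// mulr_ge0// ltW.
Qed.

(* Peeling: at each scale [x / 2 * 2 ^ k] the drift exceeds the maximum of the
   noise. *)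
Lemma drift_dominates x delta : 0 < x -> x <= m -> 0 <= delta <= 1 ->
  exists B : set T, [/\ measurable B,
    (P B <= (12 * (8 * E * q%:R / (n%:R * x * (delta + x) ^+ 2)) ^+ q)%:E)%E &
    forall w, ~ B w -> (exists l, x / 2 <= xi l w < x) /\
      forall v (A : {set 'I_n}), x / 2 <= v ->
      (forall l, 0 <= xi l w < v -> l \in A) ->
      {in A, forall l, 0 <= xi l w <= v} ->
      \sum_(l in A) (e l w - delta - A1 * xi l w) < 0].
Proof.
move=> x0 xm /andP[delta0 delta1]; move: (m_le1) (A3_gt0) (E_A3) => m1 A3_0 EA3.
have N0 : 0 < n%:R :> R by rewrite ltr0n.
pose z k : R := x / 2 * 2 ^+ k.
have z0 k : 0 < z k by rewrite mulr_gt0 ?exprn_gt0// divr_gt0.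
have z1 : z 1%N = x by rewrite /z expr1; field.
have zS k : z k.+1 = 2 * z k by rewrite /z exprS; ring.
have zup v : exists k, v < z k.
  exists (Num.truncn (v / (x / 2))).+1; rewrite /z -ltr_pdivrMl ?divr_gt0// mulrC.
  apply: lt_trans (truncnS_gt _) _.
  by rewrite -natrX ltr_nat ltn_expl.
have [K mK] := zup m.
have zmono k l : (k <= l)%N -> z k <= z l.
  by move=> kl; rewrite ler_pM2l ?divr_gt0// ler_eXn2l// ltr1n.
have zK k : z k <= m -> (k < K)%N.
  by move=> zk; rewrite ltnNge; apply/negP => /zmono; rewrite leNgt (le_lt_trans zk).
set r := (8 * E * _ / _) ^+ q.
have E0 : 0 < E by rewrite -(pmulr_lgt0 _ A3_0); lra.
have dx0 : 0 < delta + x by rewrite ltr_wpDl.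
have den0 : 0 < n%:R * x * (delta + x) ^+ 2 by rewrite !mulr_gt0 ?exprn_gt0.
have r0 : 0 <= r.
  by rewrite exprn_ge0// divr_ge0 ?mulr_ge0// ltW.
have /choice[B HB] : forall k, exists B : set T,
    [/\ measurable B, (P B <= (6 * r * 2 ^- k)%:E)%E &
    z k <= m -> forall w, ~ B w -> (exists l, z k / 2 <= xi l w < z k) /\
      forall v (A : {set 'I_n}), z k <= v <= 2 * z k ->
      (forall l, 0 <= xi l w < v -> l \in A) ->
      {in A, forall l, 0 <= xi l w <= v} ->
      \sum_(l in A) (e l w - delta - A1 * xi l w) < 0].
  move=> k; have k20 : 0 < 2 ^+ k :> R by rewrite exprn_gt0.
  have k21 : 1 <= 2 ^+ k :> R by rewrite exprn_ege1// ler1n.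
  have [zm|zm] := leP (z k) m; last first.
    by exists set0; split => //; rewrite measure0 lee_fin !mulr_ge0 ?invr_ge0// ltW.
  have [|B [mB PB HB]] := drift_one_scale (delta := delta) (z0 k) zm; first by rewrite delta0.
  exists B; split => // {HB}; apply: le_trans PB _; rewrite lee_fin -[leRHS]mulrA ler_pM2l//.
  have dz0 : 0 < delta + z k by rewrite ltr_wpDl.
  (* [z k] is 2^k x / 2 and [delta + z k] is at least half of [delta + x]: together these lose the
     factor 8 and gain 2^k. *)
  apply: (@le_trans _ _ ((8 * E * q%:R / (n%:R * x * (delta + x) ^+ 2) * 2 ^- k) ^+ q)).
    apply: lerXn2r; rewrite ?nnegrE ?divr_ge0 ?mulr_ge0 ?exprn_ge0 ?(ltW E0) ?(ltW dx0) ?(ltW dz0) ?(ltW x0) ?(ltW (z0 k))//.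
    rewrite ler_pdivrMr ?mulr_gt0 ?exprn_gt0//.
    have -> : 8 * E * q%:R / (n%:R * x * (delta + x) ^+ 2) / 2 ^+ k * (n%:R * z k * (delta + z k) ^+ 2) =
      E * q%:R * ((2 * (delta + z k)) ^+ 2 / (delta + x) ^+ 2).
      by rewrite /z; field; rewrite !gt_eqF.
    rewrite -[leLHS]mulr1; apply: ler_wpM2l; first by rewrite mulr_ge0// ltW.
    rewrite ler_pdivlMr ?exprn_gt0// mul1r; apply: lerXn2r; rewrite ?nnegrE ?mulr_ge0 ?(ltW dx0) ?(ltW dz0)//.
    have : x / 2 * 1 <= z k by rewrite ler_pM2l// divr_gt0.
    by lra.
  rewrite exprMn -/r; apply: ler_wpM2l => //.
  rewrite -[leRHS]expr1; apply: ler_wiXn2l; rewrite ?invr_ge0 ?(ltW k20)//.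
    by rewrite invf_le1.
  exact: leq_trans q4.
have HBK k : (k < K)%N -> measurable (B k) /\ (P (B k) <= (6 * r * 2 ^- k)%:E)%E.
  by move=> _; have [] := HB k.
have [mU PU] := union_bound HBK.
exists (\bigcup_(k < K) B k); split => //.
  apply: le_trans PU _; rewrite lee_fin -mulr_sumr.
  have -> : 12 * r = 6 * r * 2 by ring.
  by apply: ler_wpM2l (sum_half_powers R K); rewrite mulr_ge0.
move=> w nB; have nBk k : z k <= m -> ~ B k w.
  by move=> zm Bkw; apply: nB; exists k => //=; exact: zK.
split.
  have [_ _ HB1] := HB 1%N; rewrite z1 in HB1.
  by have [] := HB1 xm w (nBk 1%N _); rewrite ?z1.
(* No sample lies beyond [m], so [v0] may be lowered to [m]; this places [v] in one of the finitely
   many scales. *)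
move=> v0 A xv0 vA0 Av0; pose v := Num.min v0 m.
have vA l : 0 <= xi l w < v -> l \in A.
  by move=> /andP[l0]; rewrite lt_min => /andP[lv0 _]; apply: vA0; rewrite l0.
have Av : {in A, forall l, 0 <= xi l w <= v}.
  by move=> l /Av0/andP[l0 lv0]; rewrite l0 le_min lv0 xi_le.
have xv : x / 2 <= v by rewrite le_min xv0/=; lra.
have vm : v <= m by rewrite ge_min lexx orbT.
case: (ex_minnP (zup v)) => -[|k] vz mink.
  by move: vz; rewrite /z expr0 mulr1 ltNge xv.
have zv : z k <= v by rewrite leNgt; apply/negP => /mink; rewrite ltnn.
have zm := le_trans zv vm.
have [_ _ /(_ zm w (nBk k zm))[_ HBk]] := HB k; apply: HBk vA Av.
by rewrite zv -zS ltW.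
Qed.

End chaining.

(** * Exponential moments of the noise on events of the design *)

(** The second-order remainder is at most [y ^+ 2 * expR |y|]. With [x ^+ 2 <= 2 * expR |x|] it is
    controlled by the exponential moments at 2 and -2 alone, uniformly in [theta]. *)
Lemma expR_quadratic (R : realType) (theta x : R) : -1 <= theta <= 1 ->
  expR (theta * x) <=
  1 + theta * x + 4 * theta ^+ 2 * (expR (2 * x) + expR (- 2 * x)).
Proof.
move=> /andP[th1 th2].
have quad (y : R) : expR y <= 1 + y + y ^+ 2 * expR `|y|.
  have e1 : expR y - 1 <= y * expR y.
    have := expR_ge1Dx (- y); rewrite -(ler_pM2r (expR_gt0 y)) -expRD addNr expR0.
    by lra.
  have e2 := expR_ge1Dx y; have e3 : 1 <= expR `|y| by rewrite -expR0 ler_expR.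
  suff : y * (expR y - 1) <= y ^+ 2 * expR `|y| by lra.
  have [y0|y0] := ger0P y.
    by rewrite expr2 -mulrA; apply: ler_wpM2l.
  have : y ^+ 2 * 1 <= y ^+ 2 * expR (- y).
    by apply: ler_wpM2l; [exact: sqr_ge0|rewrite ltr0_norm in e3].
  by nra.
apply: le_trans (quad _) _; rewrite lerD2l exprMn.
have thx : `|theta * x| <= `|x|.
  by rewrite normrM ler_piMl// ler_norml th1.
have x2 : x ^+ 2 <= 2 * expR `|x|.
  have := expR_ge1Dxn 1 (normr_ge0 x); rewrite -normrX ger0_norm ?sqr_ge0//.
  by rewrite (_ : (2`!)%:R = 2 :> R)//; lra.
have ee : expR `|x| * expR `|x| <= expR (2 * x) + expR (- 2 * x).
  rewrite -expRD; have [x0|x0] := ger0P x.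
    by rewrite (_ : x + x = 2 * x); [rewrite lerDl expR_ge0|ring].
  by rewrite (_ : - x - x = - 2 * x); [rewrite lerDr expR_ge0|ring].
rewrite -[leLHS]mulrA [4 * _]mulrC -[leRHS]mulrA; apply: ler_wpM2l; first exact: sqr_ge0.
have : x ^+ 2 * expR `|theta * x| <= 2 * expR `|x| * expR `|x|.
  apply: ler_pM; rewrite ?sqr_ge0 ?expR_ge0//.
  by rewrite ler_expR.
have : 0 < expR `|x| * expR `|x| by rewrite mulr_gt0.
by move: ee; rewrite -!mulrA; nra.
Qed.

Lemma expR_norm_le (R : realType) (x : R) : expR `|x| <= expR x + expR (- x).
Proof. by have [x0|x0] := ger0P x; rewrite ?lerDl ?lerDr expR_ge0. Qed.

Section mgf_on_events.
Context d (T : measurableType d) (R : realType) (P : probability T R).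
Variables (X e : T -> R) (c : R).
Hypotheses (mX : measurable_fun setT X) (me : measurable_fun setT e).
Hypothesis c_ge0 : 0 <= c.
Hypothesis int_e : P.-integrable setT (EFin \o e).
Hypothesis e_mean0 : forall B, measurable B ->
  (\int[P]_(w in X @^-1` B) (e w)%:E = 0)%E.
Hypothesis mgf_e : forall theta B, -2 <= theta <= 2 -> measurable B ->
  (\int[P]_(w in X @^-1` B) (expR (theta * e w))%:E <= c%:E * P (X @^-1` B))%E.

Section event.
Variables (B : set R) (b : R).
Hypotheses (mB : measurable B) (Pb : (P (X @^-1` B) <= b%:E)%E).
Let D := X @^-1` B.
Let mD : measurable D. Proof. by rewrite -[D]setTI; exact: mX. Qed.

Let b0 : 0 <= b.
Proof. by rewrite -lee_fin; apply: le_trans Pb. Qed.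

Let mexp theta : measurable_fun D (fun w => (expR (theta * e w))%:E).
Proof.
apply/measurable_EFinP/measurable_funTS; apply: measurableT_comp => //.
exact: measurable_funM.
Qed.

Let mgf_b theta : -2 <= theta <= 2 ->
  (\int[P]_(w in D) (expR (theta * e w))%:E <= (c * b)%:E)%E.
Proof.
by move=> th; apply: le_trans (mgf_e th mB) _; rewrite EFinM lee_wpmul2l.
Qed.

(** Off [D] the integrand is 1, so the whole integral is at most [1 + r], hence at most [expR r]: a
    form that can be raised to the power [n]. *)
Let int_outside (F : T -> R) (r : R) :
    measurable_fun setT F -> (forall w, 0 <= F w) ->
    (forall w, ~ D w -> F w = 1) ->
    (\int[P]_(w in D) (F w)%:E <= P D + r%:E)%E ->
  (\int[P]_w (F w)%:E <= (expR r)%:E)%E.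
Proof.
move=> mF F0 F1 FD.
rewrite -(setUv D) ge0_integral_setU//=; last 4 first.
- exact: measurableC.
- exact/measurable_EFinP/measurable_funTS.
- by move=> w _; rewrite lee_fin.
- by apply/disj_setPS; rewrite setICr.
rewrite [X in (_ + X <= _)%E](_ : _ = P (~` D)); last first.
  under eq_integral => w /[!inE] nD do rewrite (F1 w nD).
  by rewrite integral_cst ?mul1e//; exact: measurableC.
apply: (@le_trans _ _ (1 + r%:E)%E); last by rewrite -EFinD lee_fin expR_ge1Dx.
apply: le_trans (leeD FD (lexx _)) _.
have : (P D + P (~` D) = 1)%E.
  by rewrite probability_setC// addeC subeK// fin_num_measure.
by move=> <-; rewrite addeAC.
Qed.

Let integrable_e : P.-integrable D (EFin \o e).
Proof. exact: integrableS int_e. Qed.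

Let integrable_exp theta : -2 <= theta <= 2 ->
  P.-integrable D (fun w => (expR (theta * e w))%:E).
Proof.
move=> th; apply/integrableP; split; first exact: mexp.
under eq_integral do rewrite /= ger0_norm ?expR_ge0//.
exact: le_lt_trans (mgf_b th) (ltry _).
Qed.

Let integrable_one : P.-integrable D (cst 1%:E).
Proof. exact: finite_measure_integrable_cst. Qed.

Let m1B (h : T -> R) : measurable_fun setT h ->
  measurable_fun setT (fun w => \1_B (X w) * h w).
Proof.
by move=> mh; apply: measurable_funM => //; exact: measurableT_comp.
Qed.

Let indicT w : D w -> \1_B (X w) = 1 :> R.
Proof. by move=> Dw; rewrite indicE mem_set. Qed.

Let indicF w : ~ D w -> \1_B (X w) = 0 :> R.
Proof. by move=> Dw; rewrite indicE memNset. Qed.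

(* As [c] may exceed 1, the bound on the exponential moment cannot be raised to the
   power [n]; the mean 0 turns it into [1 + O(theta ^+ 2)] times the probability. *)
Lemma mgf_indic theta : -1 <= theta <= 1 ->
  (\int[P]_w (expR (theta * (\1_B (X w) * e w)))%:E <=
   (expR (8 * c * b * theta ^+ 2))%:E)%E.
Proof.
move=> /[dup] th /andP[th1 th2]; apply: int_outside.
- by apply: measurableT_comp => //; apply: measurable_funM => //; exact: m1B.
- by move=> w; exact: expR_ge0.
- by move=> w /indicF ->; rewrite mul0r mulr0 expR0.
have th22 : (-2 <= (2 : R) <= 2) by lra.
have th2m : (-2 <= (- 2 : R) <= 2) by lra.
pose G1 w : \bar R := (1%:E + theta%:E * (e w)%:E)%E.
pose G2 w : \bar R := ((4 * theta ^+ 2)%:E * ((expR (2 * e w))%:E + (expR (- 2 * e w))%:E))%E.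
have iG1 : P.-integrable D G1.
  by apply: integrableD => //; exact: integrableZl.
have iexp : P.-integrable D (fun w => (expR (2 * e w))%:E + (expR (- 2 * e w))%:E)%E.
  by apply: integrableD => //; exact: integrable_exp.
have iG2 : P.-integrable D G2 by exact: integrableZl.
apply: (@le_trans _ _ (\int[P]_(w in D) (G1 w + G2 w))%E).
  apply: ge0_le_integral => //.
  - apply/measurable_EFinP/measurable_funTS; apply: measurableT_comp => //.
    by apply: measurable_funM => //; exact: m1B.
  - exact: measurable_int (integrableD mD iG1 iG2).
  - move=> w Dw; rewrite indicT// mul1r lee_fin; exact: expR_quadratic.
rewrite integralD//; apply: leeD.
  rewrite integralD//; last exact: integrableZl.
  rewrite integralZl// e_mean0// mule0 adde0 integral_cst// mul1e.
  exact: lexx.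
rewrite integralZl//.
have -> : 8 * c * b * theta ^+ 2 = 4 * theta ^+ 2 * (c * b + c * b) by ring.
rewrite [leRHS]EFinM; apply: lee_wpmul2l; first by rewrite lee_fin mulr_ge0// sqr_ge0.
rewrite integralD//; try exact: integrable_exp.
by rewrite EFinD; apply: leeD; exact: mgf_b.
Qed.

(** Absolute values are not centred, so the exponent is linear in [b] without a factor [theta ^+ 2].
    This suffices on the shortest cells and for very large deviations. *)
Lemma mgf_norm_indic :
  (\int[P]_w (expR (\1_B (X w) * `|e w|))%:E <= (expR (2 * c * b))%:E)%E.
Proof.
apply: int_outside.
- by apply: measurableT_comp => //; apply: m1B; exact: measurableT_comp.
- by move=> w; exact: expR_ge0.
- by move=> w /indicF ->; rewrite mul0r expR0.
have th1 : (-2 <= (1 : R) <= 2) by lra.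
have th1m : (-2 <= (- 1 : R) <= 2) by lra.
apply: (@le_trans _ _ (\int[P]_(w in D) ((expR (1 * e w))%:E + (expR (- 1 * e w))%:E))%E).
  apply: ge0_le_integral => //.
  - apply/measurable_EFinP/measurable_funTS; apply: measurableT_comp => //.
    by apply: m1B; exact: measurableT_comp.
  - by apply: emeasurable_funD; exact: mexp.
  - by move=> w Dw; rewrite indicT// !mul1r mulN1r -EFinD lee_fin; exact: expR_norm_le.
rewrite ge0_integralD//; try by move=> w _; rewrite lee_fin expR_ge0.
have -> : 2 * c * b = c * b + c * b by ring.
rewrite -[leLHS]add0e; apply: leeD => //.
by rewrite EFinD; apply: leeD; exact: mgf_b.
Qed.

End event.

(** As [expR (- 1) <= 1/2], the integrand is at most 1 minus half the indicator. It serves to bound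
    sample counts from below. *)
Lemma mgf_neg_indic (B : set R) (a : R) : measurable B -> (a%:E <= P (X @^-1` B))%E ->
  (\int[P]_w (expR (- \1_B (X w)))%:E <= (expR (- (a / 2)))%:E)%E.
Proof.
move=> mB aP; pose D := X @^-1` B.
have mD : measurable D by rewrite -[D]setTI; exact: mX.
have e2 : expR (- 1) <= 2^-1 :> R.
  by rewrite expRN lef_pV2 ?posrE ?expR_gt0//; have := expR_ge1Dx (1 : R); lra.
have PDfin : P D \is a fin_num by exact: fin_num_measure.
apply: (@le_trans _ _ (\int[P]_w (2^-1%:E + 2^-1%:E * (\1_(~` D) w)%:E))%E).
  apply: ge0_le_integral => //.
  - apply/measurable_EFinP; apply: measurableT_comp => //; apply: measurable_funN.
    by apply: measurableT_comp => //; exact: measurable_indic.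
  - apply: emeasurable_funD => //; apply/measurable_funeM/measurable_EFinP/measurable_indic.
    exact: measurableC.
  - move=> w _; rewrite -EFinM -EFinD lee_fin !indicE in_setC.
    have [wB|wB] := boolP (w \in D).
      by rewrite (_ : (X w \in B) = true) ?mulr0 ?addr0//; move: wB; rewrite !inE.
    rewrite (_ : (X w \in B) = false) ?oppr0 ?expR0 ?mulr1; first by lra.
    by apply/negbTE; move: wB; rewrite !notin_setE.
have mDC : measurable_fun setT (fun w => (\1_(~` D) w : R)%:E).
  by apply/measurable_EFinP/measurable_indic; exact: measurableC.
rewrite ge0_integralD//; last exact: measurable_funeM.
rewrite ge0_integralZl//.
have -> : (\int[P]_w (\1_(~` D) w)%:E = 1 - P D)%E.
  rewrite integral_indic//; last exact: measurableC.
  by rewrite setIT; exact: probability_setC.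
have -> : (\int[P]__ (2^-1)%:E = (2^-1 : R)%:E)%E.
  by rewrite integral_cst// -[RHS]mule1; congr (_ * _)%E; exact: probability_setT.
rewrite -(fineK PDfin) -EFinB -EFinM -EFinD lee_fin.
apply: le_trans (expR_ge1Dx _).
by move: aP; rewrite -/D -(fineK PDfin) lee_fin; lra.
Qed.

End mgf_on_events.

(** * Tail bounds for the estimator and its inverse *)

Section conditional_bound.
Local Open Scope ereal_scope.
Context d d' (T : measurableType d) (T' : measurableType d') (R : realType).
Variables (P : probability T R) (X : T -> T').
Hypothesis mX : measurable_fun setT X.

(** The version [W] may take negative values; its positive part obeys the same bound, and only
    nonnegative integrals are compared. *)
Lemma cond_exp_le (Z W : T -> \bar R) (c : R) : (0 <= c)%R ->
    is_cond_exp P X Z W -> {ae P, forall w, W w <= c%:E} ->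
  forall B, measurable B ->
  \int[P]_(w in X @^-1` B) Z w <= c%:E * P (X @^-1` B).
Proof.
move=> c0 [mW WZ] Wc B mB; rewrite -WZ//.
have mD : measurable (X @^-1` B) by rewrite -[X @^-1` B]setTI; exact: mX.
have mWT : measurable_fun setT W.
  move=> _ C mC; have [A mA] := mW measurableT C mC.
  by rewrite !setTI => <-; rewrite -[X @^-1` A]setTI; exact: mX.
rewrite -(integral_cst P mD c%:E) [leLHS]integralE.
apply: (@le_trans _ _ (\int[P]_(w in X @^-1` B) W^\+ w)).
  by apply: geeDl; rewrite oppe_le0 integral_ge0.
apply: ae_ge0_le_integral => //.
- by apply: measurable_funTS; exact: measurable_funepos.
- apply: filterS Wc => w Ww _.
  by rewrite funeposE ge_max Ww lee_fin.
Qed.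

End conditional_bound.

Section transfer.
Local Open Scope ereal_scope.
Context d0 d d' (T0 : measurableType d0) (T : measurableType d)
  (S : measurableType d') (R : realType).
Variables (P0 : probability T0 R) (P : probability T R).
Variables (V : T0 -> S) (Z : T -> S).
Hypotheses (mV : measurable_fun setT V) (mZ : measurable_fun setT Z).
Hypothesis same_law : forall B, measurable B -> P (Z @^-1` B) = P0 (V @^-1` B).

Lemma same_law_integral (G : S -> R) : measurable_fun setT G ->
    (forall s, (0 <= G s)%R) ->
  \int[P]_w (G (Z w))%:E = \int[P0]_w (G (V w))%:E.
Proof.
move=> mG G0; have mG' : measurable_fun setT (EFin \o G) by exact/measurable_EFinP.
rewrite -(@ge0_integral_pushforward _ _ _ _ _ _ mZ P setT (EFin \o G))//; last first.
  by move=> s _; rewrite lee_fin.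
rewrite -[RHS](@ge0_integral_pushforward _ _ _ _ _ _ mV P0 setT (EFin \o G))//; last first.
  by move=> s _; rewrite lee_fin.
by apply: eq_measure_integral => B mB _; exact: same_law.
Qed.

End transfer.

Section density_bounds.
Context d (T : measurableType d) (R : realType) (P : probability T R).
Variables (X : T -> R) (f : R -> R) (A3 A4 : R).
Hypotheses (A3_ge0 : 0 <= A3) (A4_ge0 : 0 <= A4).
Hypothesis mf : measurable_fun (`[0, 1] : set R) f.
Hypothesis density : forall B : set R, measurable B ->
  P (X @^-1` B) = (\int[lebesgue_measure]_(x in B `&` `[0%R, 1%R]) (f x)%:E)%E.
Hypothesis f_bounds : forall t, 0 <= t <= 1 -> A3 <= f t <= A4.

Lemma density_le (B : set R) (l : R) : measurable B ->
  (lebesgue_measure B <= l%:E)%E -> (P (X @^-1` B) <= (A4 * l)%:E)%E.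
Proof.
move=> mB Bl; rewrite density//; have mD : measurable (B `&` `[0, 1]) by exact: measurableI.
apply: (@le_trans _ _ (\int[lebesgue_measure]_(x in B `&` `[0%R, 1%R]) A4%:E)%E).
  apply: ge0_le_integral => //.
  - move=> x [_]; rewrite /= in_itv/= => x01; rewrite lee_fin.
    by have /andP[+ _] := f_bounds x01; exact: le_trans.
  - by apply/measurable_EFinP; apply: measurable_funS mf.
  - move=> x [_]; rewrite /= in_itv/= => x01; rewrite lee_fin.
    by have /andP[] := f_bounds x01.
rewrite integral_cst// EFinM lee_wpmul2l//; apply: le_trans Bl.
by apply: le_measure; rewrite ?inE//; exact: subIsetl.
Qed.

Lemma density_ge (B : set R) (l : R) : measurable B -> B `<=` `[0, 1] ->
  (l%:E <= lebesgue_measure B)%E -> ((A3 * l)%:E <= P (X @^-1` B))%E.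
Proof.
move=> mB B01 lB; rewrite density// setIidl//.
apply: (@le_trans _ _ (\int[lebesgue_measure]_(x in B) A3%:E)%E).
  by rewrite integral_cst// EFinM lee_wpmul2l.
apply: ge0_le_integral => //.
- by apply/measurable_EFinP; apply: measurable_funS mf.
- move=> x /B01; rewrite /= in_itv/= => x01; rewrite lee_fin.
  by have /andP[] := f_bounds x01.
Qed.

End density_bounds.

Section one_sided_deviation.
Context d0 (T0 : measurableType d0) d (T : measurableType d) (R : realType).
Variables (P0 : probability T0 R) (P : probability T R).
Variables (X eps : T0 -> R) (n : nat) (Xs es : 'I_n -> T -> R).
Variables (c A1 A3 A4 C1 c0 E D : R) (q : nat).
Hypotheses (mX : measurable_fun setT X) (meps : measurable_fun setT eps).
Hypotheses (mXs : forall l, measurable_fun setT (Xs l)).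
Hypotheses (mes : forall l, measurable_fun setT (es l)).
Let V0 w := (X w, eps w).
Let V l w := (Xs l w, es l w).
Hypothesis same_law : forall l B, measurable B ->
  P (V l @^-1` B) = P0 (V0 @^-1` B).
Hypothesis indep : mutually_independent P V.
Hypothesis Xs01 : forall l w, 0 <= Xs l w <= 1.
Hypothesis c_ge0 : 0 <= c.
Hypothesis int_eps : P0.-integrable setT (EFin \o eps).
Hypothesis eps_mean0 : forall B, measurable B ->
  (\int[P0]_(w in X @^-1` B) (eps w)%:E = 0)%E.
Hypothesis mgf_eps : forall theta B, -2 <= theta <= 2 -> measurable B ->
  (\int[P0]_(w in X @^-1` B) (expR (theta * eps w))%:E <=
   c%:E * P0 (X @^-1` B))%E.
Hypothesis law_le : forall (B : set R) l, measurable B ->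
  (lebesgue_measure B <= l%:E)%E -> (P0 (X @^-1` B) <= (A4 * l)%:E)%E.
Hypothesis law_ge : forall (B : set R) l, measurable B -> B `<=` `[0, 1] ->
  (l%:E <= lebesgue_measure B)%E -> ((A3 * l)%:E <= P0 (X @^-1` B))%E.
Hypotheses (A1_gt0 : 0 < A1) (A3_gt0 : 0 < A3) (C1_ge1 : 1 <= C1).
Hypothesis C1_ge : 8 * c * A4 <= C1.
Hypotheses (c0_gt0 : 0 < c0) (c0_le : c0 <= 2^-1) (c0_A3 : 16 * c0 <= A3).
Hypotheses (c0_A1A3 : 32 * c0 <= A1 * A3).
Hypotheses (DE : D = 2048 * C1) (E_D : D <= E * c0 ^+ 2) (E_A3 : 32 <= E * A3).
Hypotheses (n_gt0 : (0 < n)%N) (q4 : (4 <= q)%N).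

Let mV l : measurable_fun setT (V l). Proof. exact: measurable_fun_pair. Qed.
Let mV0 : measurable_fun setT V0. Proof. exact: measurable_fun_pair. Qed.

Let chernoff (g : R * R -> R) (r y : R) : measurable_fun setT g ->
    (\int[P0]_w (expR (g (X w, eps w)))%:E <= (expR r)%:E)%E ->
  (P [set w | (y <= \sum_l g (Xs l w, es l w))%R] <= (expR (n%:R * r - y))%:E)%E.
Proof.
move=> mg gr.
have := @independent_chernoff _ _ _ _ _ P _ V mV indep g r y mg.
rewrite card_ord; apply => l.
have mexp : measurable_fun setT (expR \o g) by exact: measurableT_comp.
by rewrite (same_law_integral mV0 (mV l) (@same_law l) mexp)//= => s; exact: expR_ge0.
Qed.

Let measurable_ge_set (h : T -> R) y : measurable_fun setT h -> measurable [set w | y <= h w].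
Proof.
move=> mh; rewrite -[X in measurable X]setTI.
rewrite [X in _ `&` X](_ : _ = h @^-1` `[y, +oo[); first exact: mh.
by apply/seteqP; split => w /=; rewrite in_itv/= andbT.
Qed.

Let chernoff_event (g : R * R -> R) (r y : R) (ev : set T) : measurable_fun setT g ->
    (\int[P0]_w (expR (g (X w, eps w)))%:E <= (expR r)%:E)%E ->
    measurable ev -> (forall w, ev w -> y <= \sum_l g (Xs l w, es l w)) ->
  (P ev <= (expR (n%:R * r - y))%:E)%E.
Proof.
move=> mg gr mev evg; apply: le_trans (chernoff y mg gr).
apply: le_measure; rewrite ?inE//.
by apply: measurable_ge_set; apply: measurable_sum => l; exact: measurableT_comp (mV l).
Qed.

(* [tau = 1] explores the design to the right of [t0], [tau = -1] to the left. *)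
Section direction.
Variables (tau t0 m : R).
Hypothesis tau1 : tau = 1 \/ tau = -1.
Hypotheses (m_le1 : m <= 1).
Hypothesis m_ub : forall x, 0 <= x <= 1 -> tau * (x - t0) <= m.
Hypothesis m_itv : forall r, 0 <= r <= m -> 0 <= t0 + tau * r <= 1.

Let slab u v := [set x | u <= tau * (x - t0) < v].

Let tau2 : tau * tau = 1.
Proof. by case: tau1 => ->; rewrite ?mul1r ?mulrNN ?mulr1. Qed.

Let slabE u v : slab u v = if tau == 1 then `[t0 + u, t0 + v[%classic
  else `]t0 - v, t0 - u]%classic.
Proof.
case: tau1 => t1; rewrite t1; apply/seteqP; split => x; rewrite /slab /= t1.
- by rewrite eqxx /= in_itv/= => /andP[h1 h2]; apply/andP; split; lra.
- by rewrite eqxx /= in_itv/= => /andP[h1 h2]; apply/andP; split; lra.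
- rewrite lt_eqF; last by lra.
  by rewrite /= in_itv/= => /andP[h1 h2]; apply/andP; split; lra.
- rewrite lt_eqF; last by lra.
  by rewrite /= in_itv/= => /andP[h1 h2]; apply/andP; split; lra.
Qed.

Let mslab u v : measurable (slab u v).
Proof. by rewrite slabE; case: ifP => _; exact: measurable_itv. Qed.

Let slab_measure u v : u <= v -> lebesgue_measure (slab u v) = (v - u)%:E.
Proof.
move=> uv; rewrite slabE; case: ifP => _; rewrite lebesgue_measure_itv/= lte_fin.
- have [->|uv'] := eqVneq u v; first by rewrite ltxx subrr.
  by rewrite ltrD2l lt_neqAle uv' uv -EFinB; congr EFin; ring.
- have [->|uv'] := eqVneq u v; first by rewrite ltxx subrr.
  by rewrite ltrD2l ltrN2 lt_neqAle uv' uv -EFinB; congr EFin; ring.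
Qed.

Let xi l w := tau * (Xs l w - t0).
Let e l w := tau * es l w.

Let sum_slab (F : 'I_n -> T -> R) u v w :
  \sum_(l | u <= xi l w < v) F l w = \sum_l \1_(slab u v) (Xs l w) * F l w.
Proof.
rewrite big_mkcond; apply: eq_bigr => l _; rewrite indicE.
case: ifPn => h; first by rewrite mem_set ?mul1r.
by rewrite memNset ?mul0r//; apply/negP.
Qed.

Let mindic u v : measurable_fun setT (fun x : R * R => \1_(slab u v) x.1 : R).
Proof. by apply: measurableT_comp => //; exact: measurable_indic. Qed.

Let mindicF u v (F : 'I_n -> T -> R) : (forall l, measurable_fun setT (F l)) ->
  measurable_fun setT (fun w => \sum_(l | u <= xi l w < v) F l w).
Proof.
move=> mF; under eq_fun do rewrite sum_slab.
apply: measurable_sum => l; apply: measurable_funM => //.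
by apply: measurableT_comp => //; exact: measurable_indic.
Qed.

(** For [tau = -1] the sign passes into the Chernoff parameter, as [mgf_indic] admits negative ones,
    and absolute values ignore it. The upper density bound turns slab widths into probabilities for
    the noise. The lower one, used for counts, needs slabs inside [0, 1], whence the restriction to
    [v <= m]. *)
Lemma one_sided_deviation x delta : 0 < x -> x <= m -> 0 <= delta <= 1 ->
  exists B : set T, [/\ measurable B,
    (P B <= (12 * (8 * E * q%:R / (n%:R * x * (delta + x) ^+ 2)) ^+ q)%:E)%E &
    forall w, ~ B w -> (exists l, x / 2 <= xi l w < x) /\
      forall v (A : {set 'I_n}), x / 2 <= v ->
      (forall l, 0 <= xi l w < v -> l \in A) ->
      {in A, forall l, 0 <= xi l w <= v} ->
      \sum_(l in A) (e l w - delta - A1 * xi l w) < 0].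
Proof.
have me l : measurable_fun setT (e l) by exact: measurable_funM.
have c8 u v : u <= v -> 8 * c * (A4 * (v - u)) <= C1 * (v - u).
  move=> uv; have -> : 8 * c * (A4 * (v - u)) = 8 * c * A4 * (v - u) by ring.
  by apply: ler_wpM2r => //; rewrite subr_ge0.
have law_slab u v : u <= v -> (P0 (X @^-1` slab u v) <= (A4 * (v - u))%:E)%E.
  by move=> uv; apply: law_le => //; rewrite slab_measure.
have A4_ge0 : 0 <= A4.
  rewrite -[A4]mulr1 -lee_fin -[1]subr0.
  exact: le_trans (measure_ge0 _ _) (law_slab 0 1 ler01).
apply: (@drift_dominates _ _ _ P n xi e C1 C1_ge1 _ _ _ _ A1 A3 m c0 E D q) => //.
- by move=> u v y; apply: measurable_ge_set; exact: mindicF.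
- move=> u v y; apply: measurable_ge_set; apply: mindicF => l; exact: measurableT_comp.
- move=> theta u v y /andP[th0 th1] uv.
  pose g (s : R * R) := theta * tau * (\1_(slab u v) s.1 * s.2).
  have mg : measurable_fun setT g.
    by apply: measurable_funM => //; apply: measurable_funM.
  have thtau : -1 <= theta * tau <= 1 by case: tau1 => ->; apply/andP; split; lra.
  have gr := mgf_indic mX meps c_ge0 int_eps eps_mean0 mgf_eps (mslab u v) (law_slab _ _ uv) thtau.
  apply: le_trans (chernoff_event (y := theta * y) mg gr _ _) _.
  + by apply: measurable_ge_set; exact: mindicF.
  + move=> w /=; rewrite sum_slab => /(ler_wpM2l th0); rewrite mulr_sumr.
    move=> /le_trans; apply; rewrite le_eqVlt; apply/orP; left; apply/eqP.
    by apply: eq_bigr => l _; rewrite /g /e /=; ring.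
  + rewrite lee_fin ler_expR lerD2r; apply: ler_wpM2l => //.
    have -> : (theta * tau) ^+ 2 = theta ^+ 2 by rewrite exprMn expr2 [tau ^+ 2]expr2 tau2 mulr1.
    rewrite [leRHS]mulrAC; apply: ler_wpM2r; first exact: sqr_ge0.
    exact: c8.
- move=> u v y uv.
  pose g (s : R * R) := \1_(slab u v) s.1 * `|s.2|.
  have mg : measurable_fun setT g.
    by apply: measurable_funM => //; exact: measurableT_comp.
  have gr := mgf_norm_indic mX meps c_ge0 mgf_eps (mslab u v) (law_slab _ _ uv).
  apply: le_trans (chernoff_event (y := y) mg gr _ _) _.
  + by apply: measurable_ge_set; apply: mindicF => l; exact: measurableT_comp.
  + move=> w /=; rewrite (sum_slab (fun l w => `|e l w|)) => /le_trans; apply.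
    rewrite le_eqVlt; apply/orP; left; apply/eqP; apply: eq_bigr => l _.
    rewrite /g /e /= normrM; congr (_ * _).
    by case: tau1 => ->; rewrite ?normrN normr1 mul1r.
  + rewrite lee_fin ler_expR lerD2r; apply: ler_wpM2l => //.
    apply: le_trans (c8 _ _ uv); apply: ler_wpM2r.
      by rewrite mulr_ge0// subr_ge0.
    by apply: ler_wpM2r => //; lra.
- by move=> l w; apply: m_ub.
- move=> u v y; rewrite [X in measurable X](_ : _ =
      [set w | - y <= - \sum_(l | u <= xi l w < v) 1]).
    by apply: measurable_ge_set; apply: measurable_funN; exact: (@mindicF u v (fun _ _ => 1)).
  by apply/seteqP; split => w /=; rewrite lerN2.
- move=> u v y u0 uv vm.
  pose g (s : R * R) : R := - \1_(slab u v) s.1.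
  have mg : measurable_fun setT g by exact: measurable_funN.
  have law : ((A3 * (v - u))%:E <= P0 (X @^-1` slab u v))%E.
    apply: law_ge => //; last by rewrite slab_measure.
    move=> r /andP[ur rv]; rewrite /= in_itv/=.
    have -> : r = t0 + tau * (tau * (r - t0)) by rewrite mulrA tau2; ring.
    by apply: m_itv; rewrite (le_trans u0 ur) (le_trans (ltW rv)).
  have gr := mgf_neg_indic mX (mslab u v) law.
  apply: le_trans (chernoff_event (y := - y) mg gr _ _) _.
  + rewrite [X in measurable X](_ : _ =
      [set w | - y <= - \sum_(l | u <= xi l w < v) 1]).
      by apply: measurable_ge_set; apply: measurable_funN; exact: (@mindicF u v (fun _ _ => 1)).
    by apply/seteqP; split => w /=; rewrite lerN2.
  + move=> w /=; rewrite (sum_slab (fun _ _ => 1)) -lerN2 => /le_trans; apply.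
    rewrite -sumrN le_eqVlt; apply/orP; left; apply/eqP.
    by apply: eq_bigr => l _; rewrite mulr1.
  + by rewrite lee_fin ler_expR mulrN opprK addrC.
Qed.

End direction.

Lemma noise_tail (y : R) :
  (P [set w | (y <= \sum_l `|es l w|)%R] <= (expR (n%:R * (2 * c) - y))%:E)%E.
Proof.
pose g (s : R * R) : R := `|s.2|.
have mg : measurable_fun setT g by exact: measurableT_comp.
have PT : (P0 (X @^-1` setT) <= 1%:E)%E by rewrite preimage_setT; exact: probability_le1.
have gr := mgf_norm_indic mX meps c_ge0 mgf_eps measurableT PT.
rewrite mulr1 in gr.
apply: (chernoff_event mg) => //.
- by apply: le_trans gr; rewrite /g; under [leRHS]eq_integral do rewrite indicT mul1r.
- by apply: measurable_ge_set; apply: measurable_sum => l; exact: measurableT_comp.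
Qed.

(** * The estimator against a level crossed by the regression function *)

Variables (mu : R -> R) (Z : 'I_n -> T -> R * R).
Hypothesis ZX : forall l w, (Z l w).1 = Xs l w.
Hypothesis Zmu : forall l w, (Z l w).2 = mu (Xs l w) + es l w.
Let muhat w := mu_hat [seq Z i w | i : 'I_n].

(** If [a <= muhat w t], the max-min bound gives a block from [t0] to beyond [t] with nonnegative
    sum of [Y - a]; these terms are at most noise minus drift, whose sum is negative. The event is
    the same for all [t], as the generalized inverse requires. *)
Lemma mu_hat_upper a t0 delta x : 0 <= t0 -> 0 < x -> t0 + x <= 1 ->
    0 <= delta <= 1 ->
    (forall r, t0 <= r <= 1 -> mu r <= a - delta - A1 * (r - t0)) ->
  exists B : set T, [/\ measurable B,
    (P B <= (12 * (8 * E * q%:R / (n%:R * x * (delta + x) ^+ 2)) ^+ q)%:E)%E &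
    forall w, ~ B w -> forall t, t0 + x <= t -> muhat w t < a].
Proof.
move=> t00 x0 t0x delta01 mu_le.
have [|r r01|r r01||B [mB PB HB]] :=
  @one_sided_deviation 1 t0 (1 - t0) (or_introl erefl) _ _ _ x delta x0 _ delta01.
- by lra.
- by lra.
- by lra.
- by lra.
exists B; split => // w /HB[[l /andP[lx1 lx2]] HA] t t0xt; rewrite ltNge; apply/negP => amu.
have t0l : t0 <= (Z l w).1 by rewrite ZX; lra.
have [v [A [tv vA Av sumA]]] := mu_hat_ge amu (ltac:(lra) : t0 <= t) t0l.
have := HA (v - t0) A ltac:(lra) _ _; rewrite ltNge => /(_ _ _)/negP; apply.
- by move=> l' /andP[l1 l2]; apply: vA; rewrite ZX; apply/andP; split; lra.
- by move=> l' /Av; rewrite ZX => /andP[l1 l2]; apply/andP; split; lra.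
apply: le_trans sumA _; apply: ler_sum => l' /Av; rewrite ZX => /andP[l1 _].
have /andP[_ l2] := Xs01 l' w.
have := mu_le (Xs l' w); rewrite l1 l2 => /(_ isT); rewrite Zmu; lra.
Qed.

Lemma mu_hat_lower a t1 delta x : t1 <= 1 -> 0 < x -> x <= t1 ->
    0 <= delta <= 1 ->
    (forall r, 0 <= r <= t1 -> a + delta + A1 * (t1 - r) <= mu r) ->
  exists B : set T, [/\ measurable B,
    (P B <= (12 * (8 * E * q%:R / (n%:R * x * (delta + x) ^+ 2)) ^+ q)%:E)%E &
    forall w, ~ B w -> forall t, t <= t1 - x -> a <= muhat w t].
Proof.
move=> t11 x0 xt1 delta01 mu_ge.
have [|r r01|r r01||B [mB PB HB]] :=
  @one_sided_deviation (-1) t1 t1 (or_intror erefl) _ _ _ x delta x0 _ delta01.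
- by lra.
- by lra.
- by lra.
- by lra.
exists B; split => // w /HB[[l /andP[lx1 lx2]] HA] t tt1; rewrite leNgt; apply/negP => mua.
(* The sample found at distance between x / 2 and x from [t1] forces the block to start at least x /
   2 to the left of [t1]. *)
have tl : t <= (Z l w).1 <= t1 - x / 2 by rewrite ZX; apply/andP; split; lra.
have [v [A [vt vA Av sumA]]] := mu_hat_lt mua tl (ltac:(lra) : t1 - x / 2 <= t1).
have := HA (t1 - v) A ltac:(lra) _ _; rewrite ltNge => /(_ _ _)/negP; apply.
- by move=> l' /andP[l1 l2]; apply: vA; rewrite ZX; apply/andP; split; lra.
- by move=> l' /Av; rewrite ZX => /andP[l1 l2]; apply/andP; split; lra.
rewrite -oppr_le0 -sumrN; apply: le_trans (ltW sumA); apply: ler_sum => l' /Av.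
rewrite ZX => /andP[_ l1]; have /andP[l2 _] := Xs01 l' w.
have := mu_ge (Xs l' w); rewrite l1 l2 => /(_ isT); rewrite Zmu; lra.
Qed.

(** * Tails of the inverse and of the estimator at the scale [s = n^(-1/3)] *)

Variables (A2 A5 c2 M s : R) (Q : nat).
Hypotheses (A2_gt0 : 0 < A2) (c2_gt0 : 0 < c2) (c2_le1 : c2 <= 1) (c2_A2 : c2 * A2 <= 1).
Hypotheses (M_ge1 : 1 <= M) (M_c : 4 * c <= M).
Hypotheses (s_gt0 : 0 < s) (ns3 : n%:R * s ^+ 3 = 1).
Hypothesis qE : q = (Q + Q)%N.
Hypothesis mu_Lip : forall x y, 0 <= x -> x <= y -> y <= 1 ->
  A1 * (y - x) <= mu x - mu y <= A2 * (y - x).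
Hypothesis mu_bound : forall x, 0 <= x <= 1 -> `|mu x| <= A5.

Let N0 : 0 < n%:R :> R. Proof. by rewrite ltr0n. Qed.

Let E0 : 0 < E.
Proof. by have A30 := A3_gt0; have EA := E_A3; rewrite -(pmulr_lgt0 _ A30); lra. Qed.

Let s_le1 : s <= 1.
Proof.
rewrite leNgt; apply/negP => s1.
have : 1 < n%:R * s ^+ 3; last by rewrite ns3 ltxx.
apply: (@lt_le_trans _ _ (s ^+ 3)); first by rewrite exprn_egt1.
by rewrite ler_peMl ?exprn_ge0 ?ler1n// ltW.
Qed.

Let mu_Lip0 x y : 0 <= x -> x <= y -> y <= 1 -> 0 <= mu x - mu y <= A2 * (y - x).
Proof.
move=> x0 xy y1; have /andP[h ->] := mu_Lip x0 xy y1; rewrite andbT.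
by apply: le_trans h; rewrite mulr_ge0 ?subr_ge0// ltW.
Qed.

Let pow2 k : 1 <= 2 ^+ k :> R. Proof. by rewrite exprn_ege1// ler1n. Qed.

Let two_sided (B1 B2 : set T) (b : R) (F : T -> R) (v r : R) :
    measurable B1 -> (P B1 <= b%:E)%E -> (forall w, ~ B1 w -> F w < v + r) ->
    measurable B2 -> (P B2 <= b%:E)%E -> (forall w, ~ B2 w -> v - r < F w) ->
  exists B : set T, [/\ measurable B, [set w | r <= `|F w - v|] `<=` B &
    (P B <= (2 * b)%:E)%E].
Proof.
move=> mB1 PB1 H1 mB2 PB2 H2.
have [mB PB] := union_bound2 (conj mB1 PB1) (conj mB2 PB2).
exists (B1 `|` B2); split => //; last by rewrite mulr_natl mulr2n.
move=> w /= rF; apply: contrapT => nB.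
have h1 := H1 w (fun b1 => nB (or_introl b1)).
have h2 := H2 w (fun b2 => nB (or_intror b2)).
by move: rF; rewrite leNgt => /negP; apply; rewrite ltr_norml; apply/andP; split; lra.
Qed.

(** On each side that matters [mu t0] is on the right side of [a], so [delta = 0] and
    [n (x / 2) ^ 3] is 2^(3k) / 8; this second 8 makes the 64. Halving the distance turns the weak
    bound on the supremum into a strict one. Where the half step leaves [0, 1], the inverse cannot
    deviate by [x]. *)
Lemma inverse_tail a k : exists B : set T, [/\ measurable B,
  [set w | 2 ^+ k * s <= `|generalized_inverse (muhat w) a - generalized_inverse mu a|] `<=` B &
  (P B <= (2 * (12 * (64 * E * q%:R) ^+ q) / 2 ^+ (k * Q))%:E)%E].
Proof.
set t0 := generalized_inverse mu a.
have /andP[t00 t01] := generalized_inverse_itv mu a; rewrite -/t0 in t00 t01.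
have k0 := pow2 k; pose x := 2 ^+ k * s.
have x0 : 0 < x by rewrite mulr_gt0//; lra.
have x20 : 0 < x / 2 by rewrite divr_gt0.
pose b := 12 * (64 * E * q%:R) ^+ q / 2 ^+ (k * Q).
have b0 : 0 <= b.
  by rewrite divr_ge0 ?exprn_ge0// mulr_ge0// exprn_ge0// !mulr_ge0// ltW.
have bE : 12 * (8 * E * q%:R / (n%:R * (x / 2) * (0 + x / 2) ^+ 2)) ^+ q <= b.
  rewrite /b -[leRHS]mulrA; apply: ler_wpM2l => //.
  have -> : 8 * E * q%:R / (n%:R * (x / 2) * (0 + x / 2) ^+ 2) =
      64 * E * q%:R / (2 ^+ k) ^+ 3.
    rewrite add0r; have -> : n%:R * (x / 2) * (x / 2) ^+ 2 = n%:R * s ^+ 3 * (2 ^+ k) ^+ 3 / 8.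
      by rewrite /x; field.
    by rewrite ns3 mul1r; field; lra.
  rewrite expr_div_n; apply: ler_wpM2l; first by rewrite exprn_ge0// !mulr_ge0// ltW.
  rewrite lef_pV2 ?posrE ?exprn_gt0//.
  rewrite -!exprM; apply: ler_weXn2l; first by rewrite ler1n.
  rewrite -mulnA leq_mul2l qE; apply/orP; right.
  by apply: leq_trans (leq_addr Q Q) _; exact: leq_pmull.
have delta01 : 0 <= (0 : R) <= 1 by rewrite lexx ler01.
have [B1 [mB1 PB1 H1]] : exists B1 : set T, [/\ measurable B1, (P B1 <= b%:E)%E &
    forall w, ~ B1 w -> generalized_inverse (muhat w) a < t0 + x].
  have [t0x|t0x] := leP (t0 + x / 2) 1; last first.
    exists set0; split; rewrite ?measure0 ?lee_fin// => w _.
    by have /andP[_] := generalized_inverse_itv (muhat w) a; lra.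
  have [r /andP[r1 r2]|B [mB PB HB]] := mu_hat_upper (a := a) t00 x20 t0x delta01.
    have : mu t0 <= a by apply: (generalized_inverse_value_le mu_Lip0); rewrite -/t0; lra.
    have /andP[+ _] := mu_Lip t00 r1 r2.
    by move: (A1 * _) => m; lra.
  exists B; split => //; first by apply: le_trans PB _; rewrite lee_fin.
  move=> w /HB Hw; apply: (@le_lt_trans _ _ (t0 + x / 2)); last by lra.
  by apply: generalized_inverse_le => [|u /andP[u1 u2]]; [lra|apply: Hw; exact: ltW].
have [B2 [mB2 PB2 H2]] : exists B2 : set T, [/\ measurable B2, (P B2 <= b%:E)%E &
    forall w, ~ B2 w -> t0 - x < generalized_inverse (muhat w) a].
  have [t0x|t0x] := leP (x / 2) t0; last first.
    exists set0; split; rewrite ?measure0 ?lee_fin// => w _.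
    by have /andP[+ _] := generalized_inverse_itv (muhat w) a; lra.
  have [r /andP[r1 r2]|B [mB PB HB]] := mu_hat_lower (a := a) t01 x20 t0x delta01.
    have : a <= mu t0 by apply: (generalized_inverse_value_ge mu_Lip0); rewrite -/t0; lra.
    have /andP[+ _] := mu_Lip r1 r2 t01.
    by move: (A1 * _) => m; lra.
  exists B; split => //; first by apply: le_trans PB _; rewrite lee_fin.
  move=> w /HB Hw; apply: (@lt_le_trans _ _ (t0 - x / 2)); first by lra.
  by apply: le_generalized_inverse; [lra|exact: Hw].
have [B [mB HB PB]] := two_sided mB1 PB1 H1 mB2 PB2 H2.
by exists B; split => //; rewrite -mulrA.
Qed.

(** With [w1 = min (2^k) (1/s)], the quantity [Y] is at least of order [w1 ^+ 2]. Its square is at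
    least of order 2^k / M: trivially if 2^k s <= 1, and otherwise because [s ^+ 4 * 2^k <= M] for
    deviations below [M n]. Squaring costs half of [q]. *)
Let scale_bound k h delta x1 : 2 ^+ k * s < M * n%:R ->
    x1 = Num.min (2 ^+ k * s) 1 / 2 -> c2 * s / 2 <= h -> c2 * x1 <= delta + h ->
  12 * (8 * E * q%:R / (n%:R * h * (delta + h) ^+ 2)) ^+ q <=
  12 * ((8 * E * q%:R) ^+ 2 * 64 * M / c2 ^+ 6) ^+ Q / 2 ^+ (k * Q).
Proof.
move=> kM x1E hs hx; have k0 := pow2 k; have s1 := s_le1.
rewrite -[leRHS]mulrA; apply: ler_wpM2l => //.
set G := 8 * E * q%:R; have G0 : 0 <= G by rewrite !mulr_ge0// ltW.
rewrite qE exprD -exprMn -expr2 exprM -expr_div_n.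
have M0 : 0 < M by exact: lt_le_trans M_ge1.
have ks0 : 0 < 2 ^+ k * s by rewrite mulr_gt0//; lra.
have x10 : 0 < x1 by rewrite x1E divr_gt0// lt_min ks0 ltr01.
have h0 : 0 < h by apply: lt_le_trans hs; rewrite divr_gt0// mulr_gt0.
have dh0 : 0 < delta + h by apply: lt_le_trans hx; rewrite mulr_gt0.
pose Y := n%:R * h * (delta + h) ^+ 2; rewrite -/Y.
have Y0 : 0 < Y by rewrite !mulr_gt0 ?exprn_gt0.
pose w1 := x1 * 2 / s; have w10 : 0 < w1 by rewrite divr_gt0 ?mulr_gt0.
have Yw : c2 ^+ 3 / 8 * w1 ^+ 2 <= Y.
  have -> : c2 ^+ 3 / 8 * w1 ^+ 2 = n%:R * (c2 * s / 2) * (c2 * x1) ^+ 2 * (n%:R * s ^+ 3)^-1.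
    by rewrite /w1; field; rewrite !gt_eqF// exprn_gt0.
  rewrite ns3 invr1 mulr1; apply: ler_pM.
  - by rewrite mulr_ge0// divr_ge0// mulr_ge0// ltW.
  - exact: sqr_ge0.
  - by rewrite ler_pM2l.
  - by apply: lerXn2r; rewrite ?nnegrE ?mulr_ge0 ?(ltW dh0)// ltW.
have w14 : 2 ^+ k <= M * w1 ^+ 4.
  rewrite /w1 x1E divfK//; have [ks1|ks1] := leP (2 ^+ k * s) 1.
    rewrite mulfK ?gt_eqF//; apply: (@le_trans _ _ ((2 ^+ k) ^+ 4)).
      by rewrite -[leLHS]expr1; apply: ler_weXn2l.
    by rewrite ler_peMl// exprn_ge0//; lra.
  rewrite div1r exprVn ler_pdivlMr ?exprn_gt0//.
  have -> : 2 ^+ k * s ^+ 4 = 2 ^+ k * s * s ^+ 3 by ring.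
  have -> : M = M * n%:R * s ^+ 3 by rewrite -mulrA ns3 mulr1.
  by rewrite ler_pM2r ?exprn_gt0// ltW.
apply: lerXn2r; rewrite ?nnegrE ?sqr_ge0//.
  by rewrite !divr_ge0 ?mulr_ge0 ?sqr_ge0 ?exprn_ge0// ltW.
have Y2 : c2 ^+ 6 / 64 * w1 ^+ 4 <= Y ^+ 2.
  have -> : c2 ^+ 6 / 64 * w1 ^+ 4 = (c2 ^+ 3 / 8 * w1 ^+ 2) ^+ 2 by field.
  by apply: lerXn2r; rewrite ?nnegrE ?(ltW Y0)// mulr_ge0 ?divr_ge0 ?exprn_ge0 ?ltW.
rewrite expr_div_n ler_pdivrMr ?exprn_gt0//.
have -> : G ^+ 2 * 64 * M / c2 ^+ 6 / 2 ^+ k * Y ^+ 2 =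
  G ^+ 2 * (64 * M / c2 ^+ 6 / 2 ^+ k * Y ^+ 2) by ring.
rewrite ler_peMr ?sqr_ge0//.
have c60 : 0 < c2 ^+ 6 by rewrite exprn_gt0.
have k00 : 0 < 2 ^+ k :> R by lra.
rewrite mulrAC ler_pdivlMr// mul1r mulrAC ler_pdivlMr//.
have := ler_wpM2l (ltW c60) w14; have := ler_wpM2l (ltW M0) Y2.
by lra.
Qed.

Let tail_const := 12 * ((8 * E * q%:R) ^+ 2 * 64 * M / c2 ^+ 6) ^+ Q.

Let tail_const_ge0 : 0 <= tail_const.
Proof.
have M0 : 0 < M by exact: lt_le_trans M_ge1.
rewrite /tail_const mulr_ge0// exprn_ge0// divr_ge0 ?exprn_ge0 ?(ltW c2_gt0)//.
by rewrite mulr_ge0 ?(ltW M0)// mulr_ge0 ?sqr_ge0.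
Qed.

Let half_step k (x1 : R) : x1 = Num.min (2 ^+ k * s) 1 / 2 ->
  [/\ s / 2 <= x1, x1 < 2 ^+ k * s & x1 <= 1].
Proof.
move=> ->; have s1 := s_le1; have s0 := s_gt0.
have ks : s <= 2 ^+ k * s by rewrite ler_peMl ?pow2// ltW.
have h : s <= Num.min (2 ^+ k * s) 1 by rewrite le_min ks.
have h1 : Num.min (2 ^+ k * s) 1 <= 2 ^+ k * s by rewrite ge_min lexx.
have h2 : Num.min (2 ^+ k * s) 1 <= 1 by rewrite ge_min lexx orbT.
by move: (Num.min _ _) h h1 h2 => m h h1 h2; split; lra.
Qed.

(* If the level [a] exceeds all values of [mu], then [t0 = 0] and the gap [delta]
   takes over the role of the distance [h], which is at least [s]. *)
Let estimator_upper_tail t k : s <= t <= 1 - s -> 2 ^+ k * s < M * n%:R ->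
  exists B : set T, [/\ measurable B, (P B <= (tail_const / 2 ^+ (k * Q))%:E)%E &
    forall w, ~ B w -> muhat w t < mu t + 2 ^+ k * s].
Proof.
move=> /andP[st t1s] kM; have s0 := s_gt0.
(* Half of the deviation keeps the level [a] strictly inside it; the cap keeps [delta <= 1]. *)
have [x1 x1E] : exists x1, x1 = Num.min (2 ^+ k * s) 1 / 2 by eexists.
have [sx1 x1k x11] := half_step x1E.
pose a := mu t + x1; pose t0 := generalized_inverse mu a.
have /andP[t00 t01] := generalized_inverse_itv mu a; rewrite -/t0 in t00 t01.
have t0t : t0 <= t.
  rewrite leNgt; apply/negP => tt0.
  have : a <= mu t0 by apply: (generalized_inverse_value_ge mu_Lip0); rewrite -/t0; lra.
  have /andP[+ _] := mu_Lip0 (ltac:(lra) : 0 <= t) (ltW tt0) t01.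
  by rewrite /a; lra.
have mut0 : mu t0 <= a by apply: (generalized_inverse_value_le mu_Lip0); rewrite -/t0; lra.
have /andP[mut mut'] := mu_Lip0 t00 t0t ltac:(lra).
pose delta := a - mu t0; pose h := t - t0.
have c20 := c2_gt0; have c21 := c2_le1; have c2A := c2_A2; have A20 := A2_gt0.
have cases : (t0 = 0) \/ delta = 0.
  have [t0_0|t0_0] := leP t0 0; first by left; lra.
  right; have : a <= mu t0 by apply: generalized_inverse_value_ge mu_Lip0 _.
  by rewrite /delta; lra.
have x1dh : x1 <= delta + A2 * h by rewrite /delta /a /h; lra.
have hx : c2 * x1 <= delta + h.
  have de0 : 0 <= delta by rewrite /delta; lra.
  have h0 : 0 <= h by rewrite /h; lra.
  have : c2 * x1 <= c2 * (delta + A2 * h) by rewrite ler_pM2l.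
  have : c2 * delta <= 1 * delta by exact: ler_wpM2r.
  have : c2 * A2 * h <= 1 * h by exact: ler_wpM2r.
  by lra.
have hs : c2 * s / 2 <= h.
  case: cases => [t0_0|de0].
    have : c2 * s <= 1 * s by apply: ler_wpM2r => //; exact: ltW.
    by rewrite /h t0_0; lra.
  have : c2 * (s / 2) <= c2 * x1 by rewrite ler_pM2l.
  by move: hx; rewrite de0 add0r; lra.
have h0 : 0 < h by apply: lt_le_trans hs; rewrite divr_gt0// mulr_gt0.
have delta01 : 0 <= delta <= 1 by move: mut0; rewrite /delta /a => mut0; apply/andP; split; lra.
have t0h : t0 + h <= 1 by rewrite /h; lra.
have [r /andP[r1 r2]|B [mB PB HB]] := mu_hat_upper (a := a) t00 h0 t0h delta01.
  have /andP[+ _] := mu_Lip t00 r1 r2.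
  by rewrite /delta; move: (A1 * _) => m; lra.
exists B; split => //.
  by apply: le_trans PB _; rewrite lee_fin; exact: scale_bound kM x1E hs hx.
move=> w /HB Hw; have := Hw t; rewrite /h addrC subrK => /(_ (lexx t)).
by rewrite /a; lra.
Qed.

Let estimator_lower_tail t k : s <= t <= 1 - s -> 2 ^+ k * s < M * n%:R ->
  exists B : set T, [/\ measurable B, (P B <= (tail_const / 2 ^+ (k * Q))%:E)%E &
    forall w, ~ B w -> mu t - 2 ^+ k * s < muhat w t].
Proof.
move=> /andP[st t1s] kM; have s0 := s_gt0.
have [x1 x1E] : exists x1, x1 = Num.min (2 ^+ k * s) 1 / 2 by eexists.
have [sx1 x1k x11] := half_step x1E.
pose a := mu t - x1; pose t1 := generalized_inverse mu a.
have /andP[t10 t11] := generalized_inverse_itv mu a; rewrite -/t1 in t10 t11.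
have tt1 : t <= t1.
  rewrite leNgt; apply/negP => t1t.
  have : mu t1 <= a by apply: (generalized_inverse_value_le mu_Lip0); rewrite -/t1; lra.
  have /andP[+ _] := mu_Lip0 t10 (ltW t1t) ltac:(lra).
  by rewrite /a; lra.
have mut1 : a <= mu t1 by apply: (generalized_inverse_value_ge mu_Lip0); rewrite -/t1; lra.
have /andP[mut mut'] := mu_Lip0 (ltac:(lra) : 0 <= t) tt1 t11.
pose delta := mu t1 - a; pose h := t1 - t.
have c20 := c2_gt0; have c21 := c2_le1; have c2A := c2_A2; have A20 := A2_gt0.
have cases : (t1 = 1) \/ delta = 0.
  have [t1_1|t1_1] := leP 1 t1; first by left; lra.
  right; have : mu t1 <= a by apply: generalized_inverse_value_le mu_Lip0 _.
  by rewrite /delta; lra.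
have x1dh : x1 <= delta + A2 * h by rewrite /delta /a /h; lra.
have hx : c2 * x1 <= delta + h.
  have de0 : 0 <= delta by rewrite /delta; lra.
  have h0 : 0 <= h by rewrite /h; lra.
  have : c2 * x1 <= c2 * (delta + A2 * h) by rewrite ler_pM2l.
  have : c2 * delta <= 1 * delta by exact: ler_wpM2r.
  have : c2 * A2 * h <= 1 * h by exact: ler_wpM2r.
  by lra.
have hs : c2 * s / 2 <= h.
  case: cases => [t1_1|de0].
    have : c2 * s <= 1 * s by apply: ler_wpM2r => //; exact: ltW.
    by rewrite /h t1_1; lra.
  have : c2 * (s / 2) <= c2 * x1 by rewrite ler_pM2l.
  by move: hx; rewrite de0 add0r; lra.
have h0 : 0 < h by apply: lt_le_trans hs; rewrite divr_gt0// mulr_gt0.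
have delta01 : 0 <= delta <= 1 by move: mut1; rewrite /delta /a => mut1; apply/andP; split; lra.
have ht1 : h <= t1 by rewrite /h; lra.
have [r /andP[r1 r2]|B [mB PB HB]] := mu_hat_lower (a := a) t11 h0 ht1 delta01.
  have /andP[+ _] := mu_Lip r1 r2 t11.
  by rewrite /delta; move: (A1 * _) => m; lra.
exists B; split => //.
  by apply: le_trans PB _; rewrite lee_fin; exact: scale_bound kM x1E hs hx.
move=> w /HB Hw; have := Hw t; rewrite /h subKr => /(_ (lexx t)).
by rewrite /a; lra.
Qed.

Let noise_const := expR (2 * A5 + 1) * (2 * q%:R) ^+ q.

(* An interval without samples makes the estimator uncontrolled with a
   probability that does not decrease with the size of the deviation; deviations
   of order [n] and more are therefore bounded through the largest response. *)
Let estimator_far_tail t k : 0 <= t <= 1 -> M * n%:R <= 2 ^+ k * s ->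
  exists B : set T, [/\ measurable B,
    [set w | 2 ^+ k * s <= `|muhat w t - mu t|] `<=` B &
    (P B <= (noise_const / 2 ^+ (k * Q))%:E)%E].
Proof.
move=> t01 kM; have s0 := s_gt0; have s1 := s_le1; have k0 := pow2 k.
pose x := 2 ^+ k * s; have x0 : 0 < x by rewrite mulr_gt0//; lra.
have M1 := M_ge1; have Mc := M_c.
exists [set w | x - 2 * A5 - 1 <= \sum_l `|es l w|]; split.
- by apply: measurable_ge_set; apply: measurable_sum => l; exact: measurableT_comp.
- move=> w /= xw.
  suff [l xl] : exists l, x - 2 * A5 - 1 <= `|es l w|.
    apply: le_trans xl _; rewrite (bigD1 l)//= lerDl.
    by apply: sumr_ge0 => *; exact: normr_ge0.
  have := mu_bound t01; rewrite ler_norml => /andP[mt1 mt2].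
  have [ge|lt] := leP (mu t + x) (muhat w t).
    have [l yl] := mu_hat_ge_exists n_gt0 ge; exists l; rewrite Zmu in yl.
    have := mu_bound (Xs01 l w); rewrite ler_norml => /andP[m1 m2].
    by have := ler_norm (es l w); lra.
  (* The slack 1 turns a weak inequality into the strict one required; it reappears in the threshold
     on the noise. *)
  have lt' : muhat w t < mu t - x + 1.
    by move: xw; rewrite -/x ler_normr => /orP[]; lra.
  have [l yl] := mu_hat_lt_exists n_gt0 lt'; exists l; rewrite Zmu in yl.
  have := mu_bound (Xs01 l w); rewrite ler_norml => /andP[m1 m2].
  by have := ler_norm (- es l w); rewrite normrN; lra.
apply: le_trans (noise_tail _) _; rewrite lee_fin.
have cx : n%:R * (2 * c) <= x / 2.
  apply: (@le_trans _ _ (M * n%:R / 2)); last by rewrite ler_pM2r.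
  by have := ler_wpM2l (ltW N0) Mc; lra.
apply: (@le_trans _ _ (expR (2 * A5 + 1) * expR (- (x / 2)))).
  by rewrite -expRD ler_expR; lra.
rewrite /noise_const -mulrA ler_pM2l ?expR_gt0//.
have x20 : 0 < x / 2 by rewrite divr_gt0.
apply: le_trans (expRN_le_power q x20) _.
have -> : q%:R / (x / 2) = 2 * q%:R / x by field; rewrite gt_eqF.
rewrite expr_div_n; apply: ler_wpM2l; first by rewrite exprn_ge0// mulr_ge0.
rewrite lef_pV2 ?posrE ?exprn_gt0//.
rewrite qE exprD -exprMn exprM; apply: lerXn2r; rewrite ?nnegrE ?exprn_ge0 ?(mulr_ge0 (ltW x0) (ltW x0))//.
(* [x >= n] and [s n >= 1] give [x ^ 2 >= x n >= 2^k]; again one half of the exponent [q] is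
   spent. *)
apply: (@le_trans _ _ (x * n%:R)).
  have sn1 : 1 <= s * n%:R.
    rewrite -[leLHS]ns3 [leRHS]mulrC ler_pM2l// exprS ler_piMr ?(ltW s0)//.
    by rewrite exprn_ile1 ?(ltW s0).
  by rewrite /x -mulrA ler_peMr ?exprn_ge0.
rewrite ler_pM2l//; apply: le_trans kM; rewrite ler_peMl//.
Qed.

Lemma estimator_tail t k : s <= t <= 1 - s -> exists B : set T, [/\ measurable B,
  [set w | 2 ^+ k * s <= `|muhat w t - mu t|] `<=` B &
  (P B <= ((2 * tail_const + noise_const) / 2 ^+ (k * Q))%:E)%E].
Proof.
move=> t01; have k0 : 0 <= (2 ^+ (k * Q))^-1 :> R by rewrite invr_ge0 exprn_ge0.
have noise0 : 0 <= noise_const.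
  by rewrite mulr_ge0 ?expR_ge0// exprn_ge0// mulr_ge0.
have [kM|kM] := ltP (2 ^+ k * s) (M * n%:R).
  have [B1 [mB1 PB1 HB1]] := estimator_upper_tail t01 kM.
  have [B2 [mB2 PB2 HB2]] := estimator_lower_tail t01 kM.
  have [B [mB HB PB]] := two_sided (F := muhat^~ t) mB1 PB1 HB1 mB2 PB2 HB2.
  exists B; split => //; apply: le_trans PB _; rewrite lee_fin mulrA.
  by apply: ler_wpM2r => //; rewrite lerDl.
have s0 := s_gt0.
have [B [mB HB PB]] := estimator_far_tail (ltac:(lra) : 0 <= t <= 1) kM.
exists B; split => //; apply: le_trans PB _; rewrite lee_fin.
apply: ler_wpM2r => //; rewrite lerDr mulr_ge0//; exact: tail_const_ge0.
Qed.

End one_sided_deviation.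

(** * The rates of convergence *)

(** Nothing is assumed of [mu] outside [0, 1]. Clamping its argument gives a function that is
    monotone on the whole line, hence measurable, and agrees with [mu] at all design points. *)
Lemma measurable_nonincreasing_clamp (R : realType) (mu : R -> R) :
    {in `[0, 1] &, {homo mu : x y /~ x <= y}} ->
  measurable_fun setT (fun x : R => mu (Num.max 0 (Num.min x 1))).
Proof.
move=> mu_noninc; apply: nonincreasing_measurable => // x y xy.
have itv (z : R) : Num.max 0 (Num.min z 1) \in `[0, 1].
  by rewrite in_itv/= le_max lexx/= ge_max ler01/= ge_min lexx orbT.
apply: mu_noninc; rewrite ?itv//.
rewrite ge_max le_max lexx/= le_max; apply/orP; right.
by rewrite le_min !ge_min xy lexx orbT.
Qed.

Theorem theorem4p1 (R : realType) (p A1 A2 A3 A4 A5 K alpha : R)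
    (p_ge1 : 1 <= p)
    (A1_gt0 : 0 < A1) (A2_gt0 : 0 < A2) (A3_gt0 : 0 < A3) (A4_gt0 : 0 < A4)
    (A5_gt0 : 0 < A5) (K_gt0 : 0 < K) (alpha_gt0 : 0 < alpha) :
  exists2 Kp : R, 0 < Kp &
  forall (* the pair (X, Y) *)
    (d0 : measure_display) (T0 : measurableType d0) (P0 : probability T0 R)
    (X Y : {RV P0 >-> R}) (mu mu' f : R -> R),
    (forall w, X w \in `[0, 1]) ->
    is_regression_function P0 X Y mu ->
    (forall theta : R, exists W : T0 -> \bar R,
       is_cond_exp P0 X (fun w => (expR (theta * (Y w - mu (X w))))%:E) W /\
       {ae P0, forall w, (W w <= (K * expR (theta ^+ 2 * alpha))%:E)%E}) ->
    measurable_fun (`[0, 1] : set R) f ->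
    (forall B : set R, measurable B ->
       P0 (X @^-1` B) =
       (\int[lebesgue_measure]_(x in B `&` `[0%R, 1%R]) (f x)%:E)%E) ->
    {in `[0, 1] &, {homo mu : x y /~ x <= y}} ->
    (forall t, t \in `[0, 1] -> has_derivative_within `[0, 1] mu t (mu' t)) ->
    (forall t, t \in `[0, 1] -> A1 < `|mu' t| < A2) ->
    (forall t, t \in `[0, 1] -> A3 < f t < A4) ->
    (forall t, t \in `[0, 1] -> `|mu t| <= A5) ->
  forall (* n independent copies of (X, Y) *)
    (n : nat) (d : measure_display) (T : measurableType d)
    (P : probability T R) (Z : 'I_n -> {RV P >-> (R * R)%type}),
    (0 < n)%N ->
    (forall i w, (Z i w).1 \in `[0, 1]) ->
    (forall i (B : set (R * R)), measurable B ->
       P (Z i @^-1` B) = P0 [set w | B (X w, Y w)]) ->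
    mutually_independent P Z ->
  let muhat w := mu_hat [seq Z i w | i : 'I_n] in
  (forall a : R,
     ('E_P[(fun w =>
         `|generalized_inverse (muhat w) a - generalized_inverse mu a| `^ p)%R]
      <= (Kp * n%:R `^ (- p / 3))%:E)%E) /\
  (forall t : R, n%:R `^ (- 1 / 3) <= t <= 1 - n%:R `^ (- 1 / 3) ->
     ('E_P[(fun w => `|muhat w t - mu t| `^ p)%R]
      <= (Kp * n%:R `^ (- p / 3))%:E)%E).
Proof.
(* All constants are fixed before any law is introduced, which is the uniformity claimed. [c] bounds
   the conditional exponential moments for parameters in [-2, 2], where [theta ^+ 2 <= 4]. *)
have [c [cE c0']] : exists c, c = K * expR (4 * alpha) /\ 0 < c.
  by eexists; split; first reflexivity; rewrite mulr_gt0// expR_gt0.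
have [C1 [C1_ge1 C1_ge]] : exists C1, 1 <= C1 /\ 8 * c * A4 <= C1.
  by exists (Num.max 1 (8 * c * A4)); rewrite !le_max !lexx orbT.
have [D DE] : exists D, D = 2048 * C1 by eexists.
have [c0 [c0_gt0 c0_le c0_A3 c0_A1A3]] : exists c0, [/\ 0 < c0, c0 <= 2^-1,
    16 * c0 <= A3 & 32 * c0 <= A1 * A3].
  exists (Num.min 2^-1 (Num.min (A3 / 16) (A1 * A3 / 32))).
  split.
  - by rewrite !lt_min !divr_gt0 ?mulr_gt0// invr_gt0 ltr0n.
  - by rewrite ge_min lexx.
  - by rewrite mulrC -ler_pdivlMr// !ge_min lexx !orbT.
  - by rewrite mulrC -ler_pdivlMr// !ge_min lexx !orbT.
have [E [E_D E_A3]] : exists E, D <= E * c0 ^+ 2 /\ 32 <= E * A3.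
  exists (Num.max (D / c0 ^+ 2) (32 / A3)).
  by rewrite -!ler_pdivrMr ?exprn_gt0// !le_max !lexx orbT.
(* [c2] turns [x1 <= delta + A2 * h] into [c2 * x1 <= delta + h]. *)
have [c2 [c2_gt0 c2_le1 c2_A2]] : exists c2, [/\ 0 < c2, c2 <= 1 & c2 * A2 <= 1].
  exists (Num.min 1 A2^-1); split; first by rewrite lt_min ltr01 invr_gt0.
    by rewrite ge_min lexx.
  by rewrite -ler_pdivlMr// div1r ge_min lexx orbT.
have [M [M_ge1 M_c]] : exists M, 1 <= M /\ 4 * c <= M.
  by exists (Num.max 1 (4 * c)); rewrite !le_max !lexx orbT.
have [q1 [q1_ge1 pq1]] : exists q1, (1 <= q1)%N /\ p <= q1%:R.
  by exists (Num.truncn p).+1; split => //; exact: ltW (truncnS_gt _).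
(* Moments up to order [q1] need tails of order [q1 + 1], doubled because the pointwise bound loses
   half of the power; [q1 >= 1] makes this at least the 4 needed in the chaining. *)
pose q := (q1.+1 + q1.+1)%N; have q4 : (4 <= q)%N by rewrite /q; clear -q1_ge1; lia.
have E0 : 0 < E by rewrite -(pmulr_lgt0 _ A3_gt0) (lt_le_trans _ E_A3).
pose Ca := 2 * (12 * (64 * E * q%:R) ^+ q).
pose Cb := 2 * (12 * ((8 * E * q%:R) ^+ 2 * 64 * M / c2 ^+ 6) ^+ q1.+1) +
  expR (2 * A5 + 1) * (2 * q%:R) ^+ q.
have Ca0 : 0 <= Ca by rewrite !mulr_ge0// exprn_ge0// !mulr_ge0// ltW.
have Cb0 : 0 <= Cb.
  apply: addr_ge0; last first.
    by apply: mulr_ge0; [exact: expR_ge0|apply: exprn_ge0; exact: mulr_ge0].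
  apply: mulr_ge0 => //; apply: mulr_ge0 => //; apply: exprn_ge0; apply: divr_ge0.
    apply: mulr_ge0; [apply: mulr_ge0 => //; exact: sqr_ge0|exact: le_trans M_ge1].
  by apply: exprn_ge0; exact: ltW.
exists ((1 + 2 ^+ q1.+1 * Ca) + (1 + 2 ^+ q1.+1 * Cb)).
  by rewrite addr_gt0// ltr_wpDr// mulr_ge0// exprn_ge0.
move=> d0 T0 P0 X Y mu mu' f X01 [int_Y condY] mgfY mf density mu_noninc dmu mu'_b f_b mu_b.
move=> n d T P Z n_gt0 Z01 Zlaw Zindep muhat.
pose mu1 x := mu (Num.max 0 (Num.min x 1)).
have mmu1 : measurable_fun setT mu1 by exact: measurable_nonincreasing_clamp.
have mu1E x : 0 <= x <= 1 -> mu1 x = mu x.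
  by move=> /andP[x0 x1]; rewrite /mu1 (min_idPl x1) (max_idPr x0).
have {}X01 w : 0 <= X w <= 1 by have := X01 w; rewrite in_itv.
have {}Z01 l w : 0 <= (Z l w).1 <= 1 by have := Z01 l w; rewrite in_itv.
pose phi (z : R * R) := (z.1, z.2 - mu1 z.1).
have mphi : measurable_fun setT phi.
  apply: measurable_fun_pair => //; apply: measurable_funB => //.
  exact: measurableT_comp.
pose eps w := Y w - mu1 (X w).
pose Xs l w := (Z l w).1.
pose es l w := (Z l w).2 - mu1 (Z l w).1.
have meps : measurable_fun setT eps.
  by apply: measurable_funB => //; exact: measurableT_comp.
have mXs l : measurable_fun setT (Xs l) by exact: measurableT_comp.
have mes l : measurable_fun setT (es l).
  by apply: measurable_funB; [|apply: measurableT_comp => //]; exact: measurableT_comp.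
have VE l B : (fun w => (Xs l w, es l w)) @^-1` B = Z l @^-1` (phi @^-1` B).
  by apply/seteqP; split => w.
have mphiB B : measurable B -> measurable (phi @^-1` B).
  by move=> mB; rewrite -[_ @^-1` _]setTI; exact: mphi.
have same_law l B : measurable B ->
    P ((fun w => (Xs l w, es l w)) @^-1` B) = P0 ((fun w => (X w, eps w)) @^-1` B).
  by move=> mB; rewrite VE Zlaw//; exact: mphiB.
have indep : mutually_independent P (fun l w => (Xs l w, es l w)).
  move=> J B mB; under eq_bigcapr do rewrite VE.
  under [RHS]eq_bigr do rewrite VE.
  by apply: (Zindep J (fun i => phi @^-1` B i)) => i; exact: mphiB.
have mX : measurable_fun setT X by [].
have muX w : mu (X w) = mu1 (X w) by rewrite mu1E.
have mD B : measurable B -> measurable (X @^-1` B).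
  by move=> mB; rewrite -[X @^-1` B]setTI; exact: mX.
have int_mu : P0.-integrable setT (EFin \o (mu1 \o X)).
  apply: measurable_bounded_integrable => //.
  - exact: le_lt_trans (probability_le1 _ measurableT) (ltry _).
  - exact: measurableT_comp.
  - exists A5; split; first exact: num_real.
    move=> r A5r w _ /=; rewrite -muX; apply: le_trans (ltW A5r); apply: mu_b.
    by rewrite in_itv/=; exact: X01.
have int_eps : P0.-integrable setT (EFin \o eps).
  rewrite (_ : EFin \o eps = (EFin \o Y) \- (EFin \o (mu1 \o X)))%E.
    exact: integrableB.
  by apply/funext => w.
have eps_mean0 B : measurable B -> (\int[P0]_(w in X @^-1` B) (eps w)%:E = 0)%E.
  move=> mB; have iY := integrableS measurableT (mD B mB) (@subsetT _ _) int_Y.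
  have imu := integrableS measurableT (mD B mB) (@subsetT _ _) int_mu.
  transitivity (\int[P0]_(w in X @^-1` B) ((EFin \o Y) w - (EFin \o (mu1 \o X)) w))%E.
    by apply: eq_integral => w _.
  rewrite (integralB (mD B mB) iY imu).
  have [_ /(_ B mB) <-] := condY.
  rewrite [X in (X - _)%E](_ : _ = (\int[P0]_(w in X @^-1` B) (EFin \o (mu1 \o X)) w)%E).
    by rewrite subee// (integrable_fin_num (mD B mB) imu).
  by apply: eq_integral => w _; rewrite /= muX.
have mgf_eps theta B : -2 <= theta <= 2 -> measurable B ->
    (\int[P0]_(w in X @^-1` B) (expR (theta * eps w))%:E <=
     c%:E * P0 (X @^-1` B))%E.
  move=> /andP[th1 th2] mB; have [W [condW Wle]] := mgfY theta.
  have th4 : theta ^+ 2 * alpha <= 4 * alpha.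
    by apply: ler_wpM2r; [exact: ltW|nra].
  have := cond_exp_le mX (ltW c0') condW _ mB.
  under eq_integral do rewrite muX; apply.
  apply: filterS Wle => w /le_trans; apply.
  by rewrite lee_fin cE ler_pM2l// ler_expR.
have f_b' t : 0 <= t <= 1 -> A3 <= f t <= A4.
  move=> t01; have := f_b t; rewrite in_itv/= => /(_ t01)/andP[h1 h2].
  by rewrite !ltW.
have law_le := density_le (ltW A3_gt0) (ltW A4_gt0) mf density f_b'.
have law_ge := density_ge (ltW A3_gt0) mf density f_b'.
have mu_Lip x y := bi_Lipschitz mu_noninc dmu mu'_b (x := x) (y := y).
have mu_bound x : 0 <= x <= 1 -> `|mu x| <= A5.
  by move=> x01; apply: mu_b; rewrite in_itv.
have ZX l w : (Z l w).1 = Xs l w by [].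
have Zmu l w : (Z l w).2 = mu (Xs l w) + es l w.
  by rewrite /es mu1E// addrC subrK.
pose s : R := n%:R `^ (- 1 / 3).
have N0 : 0 < n%:R :> R by rewrite ltr0n.
have s_gt0 : 0 < s by exact: powR_gt0.
have ns3 : n%:R * s ^+ 3 = 1.
  rewrite -(powR_mulrn 3 (ltW s_gt0)) -powRrM divfK// powR_inv1 ?(ltW N0)//.
  by rewrite divff// gt_eqF.
have sp : n%:R `^ (- p / 3) = s `^ p.
  by rewrite -powRrM; congr (_ `^ _); field.
have p0 : 0 <= p by exact: le_trans p_ge1.
rewrite sp; split=> [a|t t01].
  apply: le_trans (moment_le_of_dyadic_tails (q := q1) (C := Ca) p0 pq1 s_gt0 Ca0 _ _) _.
  - by move=> w.
  - move=> k; exact: (inverse_tail mX meps mXs mes same_law indep Z01 (ltW c0') int_eps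
      eps_mean0 mgf_eps law_le law_ge A1_gt0 A3_gt0 C1_ge1 C1_ge c0_gt0 c0_le c0_A3
      c0_A1A3 DE E_D E_A3 n_gt0 q4 ZX Zmu s_gt0 ns3 (erefl q) mu_Lip a k).
  - rewrite lee_fin; apply: ler_wpM2r; first exact: powR_ge0.
    by rewrite lerDl addr_ge0// mulr_ge0// exprn_ge0.
apply: le_trans (moment_le_of_dyadic_tails (q := q1) (C := Cb) p0 pq1 s_gt0 Cb0 _ _) _.
- by move=> w.
- move=> k; exact: (estimator_tail mX meps mXs mes same_law indep Z01 (ltW c0') int_eps
    eps_mean0 mgf_eps law_le law_ge A1_gt0 A3_gt0 C1_ge1 C1_ge c0_gt0 c0_le c0_A3
    c0_A1A3 DE E_D E_A3 n_gt0 q4 ZX Zmu A2_gt0 c2_gt0 c2_le1 c2_A2 M_ge1 M_c s_gt0 ns3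
    (erefl q) mu_Lip mu_bound k t01).
- rewrite lee_fin; apply: ler_wpM2r; first exact: powR_ge0.
  by rewrite lerDr addr_ge0// mulr_ge0// exprn_ge0.
Qed.
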